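(* Let $F\in\mathbb{R}^{K\times N}$ satisfy $F^\top F=\nu\,\mathrm{Id}$ for some $\nu>0$, let $1\le S\le J$ be integers, let $g_1,\ldots,g_S\in\Gamma_0(\mathbb{R}^N)$ and $f_{S+1},\ldots,f_J\in\Gamma_0(\mathbb{R}^K)$. Suppose that: 1. $\lim_{\|x\|\to+\infty}\ g_1(F^\top x)+\cdots+g_S(F^\top x)+f_{S+1}(x)+\cdots+f_J(x)=+\infty$; 2. $\big(\bigcap_{j=1}^{S}\mathrm{rint}\,\mathrm{dom}\,(g_j\circ F^\top)\big)\cap\big(\bigcap_{j=S+1}^{J}\mathrm{rint}\,\mathrm{dom}\, f_j\big)\neq\varnothing$; 3. for every $j\in\{1,\ldots,S\}$, $\sum_{\ell\in\mathbb{N}}\lambda_\ell\,\|\widetilde a_{j,\ell}\|<+\infty$, and for every $j\in\{S+1,\ldots,J\}$, $\sum_{\ell\in\mathbb{N}}\lambda_\ell\,\|a_{j,\ell}\|<+\infty$; 4. $\sum_{\ell\in\mathbb{N}}\lambda_\ell(2-\lambda_\ell)=+\infty$. Then the sequence $(x_\ell)_{\ell\in\mathbb{N}}$ generated by the accelerated Parallel ProXimal Algorithm (defined in the context, with parameters $\gamma$, $(\omega_j)$, $(\lambda_\ell)$, arbitrary initial points $(u_{j,0})$ and error terms $(\widetilde a_{j,\ell})$, $(a_{j,\ell})$) converges to a solution of the problem $$\text{find}\quad \widehat x\in\underset{x\in\mathbb{R}^K}{\mathrm{Argmin}}\ \sum_{j=1}^{S}g_j(F^\top x)+\sum_{j=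S+1}^{J}f_j(x).$$
   Context: $\Gamma_0(\mathbb{R}^n)$ is the class of proper lower semicontinuous convex functions $\varphi:\mathbb{R}^n\to\,]-\infty,+\infty]$; $\mathrm{dom}\,\varphi=\{x:\varphi(x)<+\infty\}$; $\mathrm{rint}$ denotes relative interior; $\mathrm{prox}_\varphi(u)$ is the unique minimizer over $v$ of $\frac12\|v-u\|^2+\varphi(v)$. The matrix $F$ is the analysis operator of a tight frame of $\mathbb{R}^N$ with $K$ vectors and frame constant $\nu$, i.e. $F^\top F=\nu\,\mathrm{Id}$. Accelerated Parallel ProXimal Algorithm. Parameters: $\gamma\in\,]0,+\infty[$; weights $(\omega_j)_{1\le j\le J}\in\,]0,1]^J$ with $\sum_{j=1}^J\omega_j=1$; relaxation parameters $\lambda_\ell\in\,]0,2[$ for $\ell\in\mathbb{N}$; error terms $\widetilde a_{j,\ell}\in\mathbb{R}^N$ ($1\le j\le S$, $\ell\in\mathbb{N}$) and $a_{j,\ell}\in\mathbb{R}^K$ ($S+1\le j\le J$, $\ell\in\mathbb{N}$). Initialization: $(u_{j,0})_{1\le j\le J}\in(\mathbb{R}^K)^J$, $x_0=\sum_{j=1}^J\omega_ju_{j,0}$, and, for $j\in\{1,\ldots,S\}$, $v_{j,0}=F^\top u_{j,0}$ and $u_{j,0}^\perp=u_{j,0}-\frac1\nu Fv_{j,0}$. For $\ell=0,1,\ldots$: - for $j=1,\ldots,S$: $q_{j,\ell}=\frac1\nu\,\mathrm{prox}_{\nu\gamma g_j/\omega_j}(v_{j,\ell})+\widetilde a_{j,\ell}$;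 - for $j=S+1,\ldots,J$: $p_{j,\ell}=\mathrm{prox}_{\gamma f_j/\omega_j}(u_{j,\ell})+a_{j,\ell}$; - $p_\ell=\sum_{j=1}^S\omega_ju_{j,\ell}^\perp+F\sum_{j=1}^S\omega_jq_{j,\ell}+\sum_{j=S+1}^J\omega_jp_{j,\ell}$; - $r_\ell=2p_\ell-x_\ell$, $\ \widetilde r_\ell=F^\top r_\ell$, $\ r_\ell^\perp=r_\ell-\frac1\nu F\widetilde r_\ell$; - for $j=1,\ldots,S$: $u_{j,\ell+1}^\perp=u_{j,\ell}^\perp+\lambda_\ell(r_\ell^\perp-u_{j,\ell}^\perp)$ and $v_{j,\ell+1}=v_{j,\ell}+\lambda_\ell(\widetilde r_\ell-\nu q_{j,\ell})$; - for $j=S+1,\ldots,J$: $u_{j,\ell+1}=u_{j,\ell}+\lambda_\ell(r_\ell-p_{j,\ell})$; - $x_{\ell+1}=x_\ell+\lambda_\ell(p_\ell-x_\ell)$. *)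

(* Defs.v *)
From HB Require Import structures.
From mathcomp Require Import all_boot all_order all_algebra.
From mathcomp Require Import all_classical all_reals all_analysis.

Set Implicit Arguments.
Unset Strict Implicit.
Unset Printing Implicit Defensive.

Import Order.TTheory GRing.Theory Num.Theory.
Import numFieldNormedType.Exports.

Local Open Scope classical_set_scope.
Local Open Scope ring_scope.

(* Vectors of R^n are column matrices. The norm that the library puts on
   matrices is the sup norm, hence a separate Euclidean norm; both induce the
   library's (product) topology. *)
Definition enorm (R : realType) (n : nat) (x : 'cV[R]_n) : R :=
  Num.sqrt (\sum_(i < n) x i 0 ^+ 2).

Section ConvexAnalysis.
Context {R : realType} {n : nat}.
Implicit Types (phi : 'cV[R]_n -> \bar R) (C : set 'cV[R]_n) (x y u v : 'cV[R]_n).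

Definition edom phi : set 'cV[R]_n := [set x | phi x < +oo]%E.

Definition eproper phi := (forall x, phi x != -oo%E) /\ edom phi !=set0.

(* Used together with [eproper], so that no sum (+oo) + (-oo) occurs; on the
   open interval 0 < t < 1 no product 0 * +oo occurs either. *)
Definition econvex phi := forall x y (t : R), 0 < t < 1 ->
  (phi (t *: x + (1 - t) *: y)%R <= t%:E * phi x + (1 - t)%:E * phi y)%E.

Definition Gamma0 : set ('cV[R]_n -> \bar R) :=
  [set phi | [/\ eproper phi, lower_semicontinuous phi & econvex phi]].

Definition affine_set C := forall x y (t : R),
  C x -> C y -> C (t *: x + (1 - t) *: y).

Definition affine_hull C : set 'cV[R]_n :=
  \bigcap_(A in [set A | affine_set A /\ C `<=` A]) A.

(* interior of C for the topology induced on its affine hull *)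
Definition rint C : set 'cV[R]_n :=
  [set x | affine_hull C x /\ \forall y \near x, affine_hull C y -> C y].

Definition Argmin phi : set 'cV[R]_n :=
  [set x | forall y, (phi x <= phi y)%E].

(* [xget] picks an element of the set of minimizers, with junk value 0 when
   it is empty; for phi in Gamma0 this set is a singleton. *)
Definition prox phi u : 'cV[R]_n :=
  xget 0 (Argmin (fun v => (2^-1 * enorm (v - u) ^+ 2)%:E + phi v)%E).

(* phi x tends to +oo when the norm of x does *)
Definition coercive phi :=
  forall M : R, exists r : R, forall x, r < enorm x -> (M%:E < phi x)%E.

End ConvexAnalysis.

(* Families indexed by 1, ..., J are functions on nat of which only the values
   at the relevant indices matter. *)
Section PPXA.
Context {R : realType} {K N : nat}.
Variables (F : 'M[R]_(K, N)) (nu : R) (S J : nat).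
Variables (g : nat -> 'cV[R]_N -> \bar R) (f : nat -> 'cV[R]_K -> \bar R).

Definition objective (x : 'cV[R]_K) : \bar R :=
  (\sum_(1 <= j < S.+1) g j (F^T *m x) + \sum_(S.+1 <= j < J.+1) f j x)%E.

Variables (gamma : R) (omega : nat -> R) (lambda : nat -> R).
(* error terms: index j first, then the iteration *)
Variables (atilde : nat -> nat -> 'cV[R]_N) (a : nat -> nat -> 'cV[R]_K).
Variable u0 : nat -> 'cV[R]_K.

(* uperp j and vdual j are meaningful for 1 <= j <= S, uprim j for S + 1 <= j <= J *)
Record ppxa_state := PPXAState {
  uperp : nat -> 'cV[R]_K;
  vdual : nat -> 'cV[R]_N;
  uprim : nat -> 'cV[R]_K;
  xiter : 'cV[R]_K }.

Definition ppxa_init : ppxa_state :=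
  let v j := F^T *m u0 j in
  {| uperp := fun j => u0 j - nu^-1 *: (F *m v j);
     vdual := v;
     uprim := u0;
     xiter := \sum_(1 <= j < J.+1) omega j *: u0 j |}.

Definition ppxa_step (l : nat) (s : ppxa_state) : ppxa_state :=
  let x := xiter s in
  let q j := nu^-1 *: prox (fun y => (nu * gamma / omega j)%:E * g j y)%E
                           (vdual s j) + atilde j l in
  let pj j := prox (fun y => (gamma / omega j)%:E * f j y)%E
                   (uprim s j) + a j l in
  let p := \sum_(1 <= j < S.+1) omega j *: uperp s j
           + F *m (\sum_(1 <= j < S.+1) omega j *: q j)
           + \sum_(S.+1 <= j < J.+1) omega j *: pj j in
  let r := 2 *: p - x in
  let rtilde := F^T *m r in
  let rperp := r - nu^-1 *: (F *m rtilde) in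
  {| uperp := fun j => uperp s j + lambda l *: (rperp - uperp s j);
     vdual := fun j => vdual s j + lambda l *: (rtilde - nu *: q j);
     uprim := fun j => uprim s j + lambda l *: (r - pj j);
     xiter := x + lambda l *: (p - x) |}.

Fixpoint ppxa_iter (l : nat) : ppxa_state :=
  if l is l'.+1 then ppxa_step l' (ppxa_iter l') else ppxa_init.

Definition ppxa (l : nat) : 'cV[R]_K := xiter (ppxa_iter l).

End PPXA.

(* Main.v *)
Require Import Defs.
From HB Require Import structures.
From mathcomp Require Import all_boot all_order all_algebra.
From mathcomp Require Import all_classical all_reals all_analysis.
From mathcomp Require Import ring lra.

Set Implicit Arguments.
Unset Strict Implicit.
Unset Printing Implicit Defensive.

Import Order.TTheory GRing.Theory Num.Theory.
Import numFieldNormedType.Exports.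

Local Open Scope classical_set_scope.
Local Open Scope ring_scope.

(** The algorithm is the Douglas-Rachford method in disguise, run in the product
    of J copies of R^K weighted by the omega_j and applied to the separable
    function (x_j) |-> sum_j h_j (x_j) and to the indicator function of the
    diagonal, where h_j is g_j o F^T or f_j. Its points (u_j) are the columns of
    a matrix, and x_l is their weighted mean. For j <= S the tight frame lets
    one store u_j as its component orthogonal to the range of F together with
    F^T u_j, and [frame_prox] expresses the proximity operator of g_j o F^T by
    that of g_j; hence the recursion of the algorithm is exactly a perturbed
    Douglas-Rachford recursion ([ppxa_recurrence], [ppxa_product]).

    One step is a relaxation of an operator T that composes two reflections,
    across the diagonal and through the proximal points; the former is an
    isometry and the latter is nonexpansive because the subdifferential is
    monotone. If T has a fixed point, then with summable errors the iterates are
    quasi-Fejer monotone with respect to the fixed points, the residuals T u - u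
    accumulate at 0 because the sum of the lambda_l (2 - lambda_l) diverges, and
    finite dimension turns this into convergence to a fixed point
    ([krasnoselskii_mann]). The weighted mean of a fixed point minimizes the
    objective ([dr_fixed_Argmin]), whence the theorem ([douglas_rachford]).

    Existence of a fixed point is where the coercivity and the qualification
    condition enter. Coercivity gives a minimizer ([elsc_coercive_Argmin]). A
    point common to the relative interiors of the domains allows one to write 0
    as a sum of subgradients of the h_j at this minimizer ([fermat_sum_rule]),
    and a fixed point can be read off these subgradients ([dr_fixed_exists]).
    The sum rule rests on a finite-dimensional Hahn-Banach theorem
    ([linear_minorant]), which also provides the affine minorants needed for the
    existence of proximal points ([prox_subgrad]). *)

(** * Inner products and compactness *)

Section InnerProduct.
Context {R : realType} {V : lmodType R}.
Implicit Types (dot : V -> V -> R) (x y z : V).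

Record inner_product dot : Prop := InnerProduct {
  dotC : forall x y, dot x y = dot y x;
  dotDl : forall x y z, dot (x + y) z = dot x z + dot y z;
  dotZl : forall (c : R) x y, dot (c *: x) y = c * dot x y;
  dot_ge0 : forall x, 0 <= dot x x;
  dot_eq0 : forall x, dot x x = 0 -> x = 0 }.

Definition dnorm dot x := Num.sqrt (dot x x).

Context {dot : V -> V -> R} (ip : inner_product dot).
Local Notation "''[' x , y ]" := (dot x y) (format "''[' x ,  y ]").
Local Notation norm := (dnorm dot).

Lemma dotDr x y z : '[z, x + y] = '[z, x] + '[z, y].
Proof. by rewrite ip.(dotC) ip.(dotDl) !(ip.(dotC) z). Qed.

Lemma dotZr c x y : '[y, c *: x] = c * '[y, x].
Proof. by rewrite ip.(dotC) ip.(dotZl) ip.(dotC). Qed.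

Lemma dotNl x y : '[- x, y] = - '[x, y].
Proof. by rewrite -scaleN1r ip.(dotZl) mulN1r. Qed.

Lemma dotNr x y : '[y, - x] = - '[y, x].
Proof. by rewrite ip.(dotC) dotNl ip.(dotC). Qed.

Definition dotE := (ip.(dotDl), dotDr, dotNl, dotNr, ip.(dotZl), dotZr).

Lemma dot0l x : '[0, x] = 0.
Proof. by rewrite -(scale0r 0) ip.(dotZl) mul0r. Qed.

Lemma dnorm_ge0 x : 0 <= norm x.
Proof. exact: sqrtr_ge0. Qed.

Lemma sqr_dnorm x : norm x ^+ 2 = '[x, x].
Proof. by rewrite sqr_sqrtr // ip.(dot_ge0). Qed.

Lemma dnorm0 : norm 0 = 0.
Proof. by rewrite /dnorm dot0l sqrtr0. Qed.

Lemma dnorm_eq0 x : norm x = 0 -> x = 0.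
Proof. by move=> x0; apply: ip.(dot_eq0); rewrite -sqr_dnorm x0 expr0n. Qed.

Lemma dnorm_le x y : (norm x <= norm y) = ('[x, x] <= '[y, y]).
Proof. by rewrite -!sqr_dnorm ler_pXn2r ?nnegrE ?dnorm_ge0. Qed.

Lemma dnormZ (c : R) x : norm (c *: x) = `|c| * norm x.
Proof.
by rewrite /dnorm !dotE mulrA -expr2 sqrtrM ?sqr_ge0 // sqrtr_sqr.
Qed.

Lemma dnormN x : norm (- x) = norm x.
Proof. by rewrite -scaleN1r dnormZ normrN1 mul1r. Qed.

Lemma dnormB x y : norm (x - y) = norm (y - x).
Proof. by rewrite -dnormN opprB. Qed.

Lemma cauchy_schwarz x y : '[x, y] <= norm x * norm y.
Proof.
have [x0|x_neq0] := eqVneq (norm x) 0.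
  by rewrite (dnorm_eq0 x0) dot0l dnorm0 mul0r.
have [y0|y_neq0] := eqVneq (norm y) 0.
  by rewrite (dnorm_eq0 y0) ip.(dotC) dot0l dnorm0 mulr0.
have x_gt0 : 0 < norm x by rewrite lt_def x_neq0 dnorm_ge0.
have y_gt0 : 0 < norm y by rewrite lt_def y_neq0 dnorm_ge0.
have := ip.(dot_ge0) (norm y *: x - norm x *: y).
rewrite !dotE -!sqr_dnorm (ip.(dotC) y x).
set a := norm x in x_gt0 *; set b := norm y in y_gt0 *; set d := '[x, y] => h.
have : 0 <= 2 * (a * b) * (a * b - d) by lra.
by rewrite pmulr_rge0 ?subr_ge0 // !mulr_gt0.
Qed.

Lemma sqr_dnormD x y :
  norm (x + y) ^+ 2 = norm x ^+ 2 + 2 * '[x, y] + norm y ^+ 2.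
Proof. by rewrite !sqr_dnorm !dotE (ip.(dotC) y x); ring. Qed.

Lemma ler_dnormD x y : norm (x + y) <= norm x + norm y.
Proof.
rewrite -(@ler_pXn2r _ 2) ?nnegrE ?addr_ge0 ?dnorm_ge0 //.
by rewrite sqr_dnormD sqrrD; have := cauchy_schwarz x y; lra.
Qed.

(** With [x] the difference of two points and [p] that of their images by a map,
    the hypothesis is firm nonexpansiveness of that map and the conclusion is
    nonexpansiveness of the reflected map [2 p - id]. *)
Lemma firm_reflection x p : 0 <= '[x - p, p] -> norm (2 *: p - x) <= norm x.
Proof. rewrite dnorm_le !dotE (ip.(dotC) p x); lra. Qed.

Lemma ler_dnorm_sum (I : Type) (r : seq I) (P : pred I) (u : I -> V) :
  norm (\sum_(i <- r | P i) u i) <= \sum_(i <- r | P i) norm (u i).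
Proof.
elim/big_rec2: _ => [|i a x _ IH]; first by rewrite dnorm0.
by apply: le_trans (ler_dnormD _ _) _; rewrite lerD2l.
Qed.

End InnerProduct.

Section Matrices.
Context {R : realType}.

Definition edot (n : nat) (x y : 'cV[R]_n) : R := \sum_i x i 0 * y i 0.

(** The columns of a matrix are the components of a point of a product of [n]
    Euclidean spaces, weighted by [w]. *)
Definition wdot (m n : nat) (w : 'I_n -> R) (A B : 'M[R]_(m, n)) : R :=
  \sum_j w j * edot (col j A) (col j B).

Lemma edotE n (x y : 'cV[R]_n) : edot x y = (x^T *m y) 0 0.
Proof. by rewrite mxE; apply: eq_bigr => i _; rewrite mxE. Qed.

Lemma edot_inner_product n : inner_product (@edot n).
Proof.
split=> [x y|x y z|c x y|x|x].
- by apply: eq_bigr => i _; rewrite mulrC.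
- by rewrite -big_split; apply: eq_bigr => i _; rewrite mxE mulrDl.
- by rewrite /edot mulr_sumr; apply: eq_bigr => i _; rewrite mxE mulrA.
- by apply: sumr_ge0 => i _; rewrite -expr2 sqr_ge0.
move=> /eqP; rewrite psumr_eq0 => [/allP x0|i _]; last first.
  by rewrite -expr2 sqr_ge0.
apply/colP => i; have := x0 i (mem_index_enum _).
by rewrite mulf_eq0 orbb mxE => /eqP.
Qed.

Lemma enormE n : @enorm R n = dnorm (@edot n).
Proof. by apply/funext. Qed.

Lemma wdot_inner_product m n (w : 'I_n -> R) : (forall j, 0 < w j) ->
  inner_product (@wdot m n w).
Proof.
move=> w_gt0; have ip := edot_inner_product m.
have pos j (A : 'M[R]_(m, n)) : 0 <= w j * edot (col j A) (col j A).
  by apply: mulr_ge0; [exact: ltW | exact: ip.(dot_ge0)].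
split=> [A B|A B C|c A B|A|A].
- by apply: eq_bigr => j _; rewrite ip.(dotC).
- rewrite -big_split; apply: eq_bigr => j _.
  by rewrite linearD ip.(dotDl) mulrDr.
- rewrite /wdot mulr_sumr; apply: eq_bigr => j _.
  by rewrite linearZ ip.(dotZl) mulrCA.
- exact: sumr_ge0.
move=> /eqP; rewrite psumr_eq0 // => /allP A0; apply/matrixP => i j.
have := A0 j (mem_index_enum _).
rewrite mulf_eq0 gt_eqF //= => /eqP /ip.(dot_eq0) /colP /(_ i).
by rewrite !mxE.
Qed.

Lemma ler_coord_enorm n (x : 'cV[R]_n) i : `|x i 0| <= enorm x.
Proof.
rewrite -sqrtr_sqr ler_wsqrtr // (bigD1 i) //= lerDl.
by apply: sumr_ge0 => j _; exact: sqr_ge0.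
Qed.

Lemma ler_enorm_sum n (x : 'cV[R]_n) : enorm x <= \sum_i `|x i 0|.
Proof.
have ip := edot_inner_product n; rewrite enormE.
have e_norm i : dnorm (@edot n) (delta_mx i 0) = 1.
  rewrite /dnorm /edot (bigD1 i) //= big1 => [|j ji].
    by rewrite mxE !eqxx mulr1 addr0 sqrtr1.
  by rewrite mxE (negPf ji) mul0r.
have {1}-> : x = \sum_i x i 0 *: delta_mx i 0.
  rewrite {1}[x]matrix_sum_delta; apply: eq_bigr => i _.
  by rewrite big_ord1.
apply: le_trans (ler_dnorm_sum ip _ _ _) _.
by apply: ler_sum => i _; rewrite dnormZ // e_norm mulr1.
Qed.

Lemma ler_mx_norm_enorm n (x : 'cV[R]_n) : `|x| <= enorm x.
Proof.
rewrite [leLHS]/Num.norm /= mx_normrE; apply/bigmax_leP; split.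
  exact: sqrtr_ge0.
by move=> [i j] _ /=; rewrite ord1; exact: ler_coord_enorm.
Qed.

(** Flattening matrices to rows reduces the claim to compactness of a box. *)
Lemma bolzano_weierstrass_mx m n (u : nat -> 'M[R]_(m, n)) (M : R) :
  (forall l i j, `|u l i j| <= M) ->
  exists x : 'M[R]_(m, n), forall (e : R) k, 0 < e ->
    exists2 l, (k <= l)%N & forall i j, `|u l i j - x i j| < e.
Proof.
move=> u_le; pose I := `[- M, M]%classic.
have cA : compact [set v : 'rV[R]_(m * n) | forall i, I (v 0 i)].
  by apply: (@rV_compact R _ (fun=> I)) => i; exact: segment_compact.
have [|p [_ p_cluster]] := cA ((fun l => mxvec (u l)) @ \oo) _.
  exists 0%N => // l _ k /=; case/mxvec_indexP: k => i j.
  by rewrite mxvecE /I /= in_itv /= -ler_norml.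
exists (vec_mx p) => e k e_gt0.
have u_ge_k : ((fun l => mxvec (u l)) @ \oo)
    [set v | exists2 l, (k <= l)%N & v = mxvec (u l)].
  by exists k => // l kl; exists l.
have [_ [[l kl ->] [_ pu]]] := p_cluster _ _ u_ge_k (nbhsx_ballx p e e_gt0).
exists l => // i j; rewrite distrC; have := pu 0 (mxvec_index i j).
by rewrite mxvecE [X in _ -> `|X - _| < _]mxE.
Qed.

(** The form in which finite dimension enters the fixed-point theorem. *)
Definition bolzano (V : lmodType R) (dot : V -> V -> R) :=
  forall (u : nat -> V) (M : R), (forall l, dnorm dot (u l) <= M) ->
  exists x, forall (e : R) k, 0 < e ->
    exists2 l, (k <= l)%N & dnorm dot (u l - x) < e.

Lemma ler_dnorm_wdot m n (w : 'I_n -> R) (A : 'M[R]_(m, n)) :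
  (forall j, 0 < w j <= 1) ->
  dnorm (wdot w) A <= \sum_j enorm (col j A).
Proof.
move=> w01; have w_gt0 j : 0 < w j by have /andP[] := w01 j.
have ip := edot_inner_product m.
rewrite -(@ler_pXn2r _ 2) ?nnegrE ?dnorm_ge0 //; last first.
  by apply: sumr_ge0 => j _; rewrite enormE dnorm_ge0.
rewrite (sqr_dnorm (wdot_inner_product _ w_gt0)) /wdot.
set S := \sum_j enorm _; apply: le_trans (_ : \sum_j enorm (col j A) * S <= _).
  apply: ler_sum => j _; rewrite -(sqr_dnorm ip) -enormE.
  have ej k : 0 <= enorm (col k A) by rewrite enormE dnorm_ge0.
  apply: le_trans (_ : enorm (col j A) * enorm (col j A) <= _).
    by rewrite -expr2 ler_piMl ?sqr_ge0 //; have /andP[] := w01 j.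
  apply: ler_wpM2l => //; rewrite /S (bigD1 j) //= lerDl.
  by apply: sumr_ge0 => k _.
by rewrite -mulr_suml -expr2.
Qed.

Lemma ler_enorm_wdot m n (w : 'I_n -> R) (A : 'M[R]_(m, n)) j :
  (forall j, 0 < w j) ->
  Num.sqrt (w j) * enorm (col j A) <= dnorm (wdot w) A.
Proof.
move=> w_gt0; have ip := edot_inner_product m.
rewrite enormE /dnorm -sqrtrM ?(ltW (w_gt0 j)) // ler_wsqrtr //.
rewrite /wdot (bigD1 j) //= lerDl.
by apply: sumr_ge0 => k _; rewrite mulr_ge0 ?ip.(dot_ge0) // ltW.
Qed.

Lemma bolzano_wdot m n (w : 'I_n -> R) :
  (forall j, 0 < w j <= 1) -> bolzano (@wdot m n w).
Proof.
move=> w01 u M uM; have w_gt0 j : 0 < w j by have /andP[] := w01 j.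
pose B := \sum_j M / Num.sqrt (w j).
have M_ge0 : 0 <= M by apply: le_trans (uM 0%N); exact: dnorm_ge0.
have [|x xP] := @bolzano_weierstrass_mx _ _ u B.
  move=> l i j; have sw : 0 < Num.sqrt (w j) by rewrite sqrtr_gt0.
  have := ler_coord_enorm (col j (u l)) i; rewrite mxE => /le_trans; apply.
  apply: le_trans (_ : M / Num.sqrt (w j) <= _); last first.
    rewrite /B (bigD1 j) //= lerDl; apply: sumr_ge0 => k _.
    by rewrite divr_ge0 ?sqrtr_ge0.
  rewrite ler_pdivlMr // mulrC.
  by apply: le_trans (ler_enorm_wdot _ _ _) (uM l).
exists x => e k e_gt0; pose C := (n * m).+1%:R : R.
have [|l kl ul] := xP (e / C) k; first by rewrite divr_gt0 ?ltr0Sn.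
exists l => //; apply: le_lt_trans (ler_dnorm_wdot _ w01) _.
apply: le_lt_trans (_ : \sum_(j < n) \sum_(i < m) e / C < _).
  apply: ler_sum => j _; apply: le_trans (ler_enorm_sum _) _.
  by apply: ler_sum => i _; rewrite !mxE; apply/ltW/ul.
rewrite !sumr_const !card_ord -mulrnA -mulr_natr mulrAC.
by rewrite ltr_pdivrMr ?ltr0Sn // ltr_pM2l // ltr_nat mulnC.
Qed.

Lemma bolzano_edot n : bolzano (@edot n).
Proof.
have w1 (j : 'I_1) : 0 < (1 : R) <= 1 by rewrite ltr01 lexx.
have dE (x : 'cV[R]_n) : dnorm (wdot (fun=> 1)) x = dnorm (@edot n) x.
  by rewrite /dnorm /wdot big_ord1 mul1r; congr (Num.sqrt (edot _ _));
    apply/colP => i; rewrite mxE.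
move=> u M uM; have [|x xP] := bolzano_wdot w1 (u := u) (M := M).
  by move=> l; rewrite dE.
by exists x => e k /(xP e k)[l kl]; rewrite dE; exists l.
Qed.

End Matrices.

(** * Krasnoselskii-Mann iterations *)

Section KrasnoselskiiMann.
Context {R : realType} {V : lmodType R} {dot : V -> V -> R}.
Context (ip : inner_product dot).
Local Notation "''[' x , y ]" := (dot x y) (format "''[' x ,  y ]").
Local Notation norm := (dnorm dot).

Lemma dot_relaxation (t : R) x y :
  '[x + t *: (y - x), x + t *: (y - x)] =
  (1 - t) * '[x, x] + t * '[y, y] - t * (1 - t) * '[y - x, y - x].
Proof. rewrite !(dotE ip) (ip.(dotC) y x); ring. Qed.

Context (T : V -> V) (T_nonexp : forall x y, norm (T x - T y) <= norm (x - y)).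
Context (lambda : nat -> R) (lambda02 : forall l, 0 < lambda l < 2).
Context (u c : nat -> V).
Context (uS : forall l,
  u l.+1 = u l + (lambda l / 2) *: (T (u l) - u l) + lambda l *: c l).
Local Notation eps l := (lambda l * norm (c l)).
Context (B : R) (eps_sum : forall n, \sum_(0 <= l < n) eps l <= B).

Let eps_ge0 l : 0 <= eps l.
Proof.
by have /andP[l0 _] := lambda02 l; rewrite mulr_ge0 ?dnorm_ge0 // ltW.
Qed.

Let w_ge0 l : 0 <= lambda l * (2 - lambda l).
Proof.
by have /andP[l0 l2] := lambda02 l; rewrite mulr_ge0 // ?subr_ge0 ltW.
Qed.

Let eps_le l : eps l <= B.
Proof.
apply: le_trans (eps_sum l.+1).
by rewrite big_nat_recr //= lerDr; apply: sumr_ge0.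
Qed.

Let B_ge0 : 0 <= B.
Proof. by have := eps_sum 0; rewrite big_geq. Qed.

Section FixedPoint.
Context (z : V) (Tz : T z = z).

(** On the segment from [u l] to [T (u l)] the squared norm lies below its
    linear interpolation by the product of the two weights times the squared
    residual; nonexpansiveness bounds the distance at the far end. *)
Lemma relaxation_descent l :
  norm (u l + (lambda l / 2) *: (T (u l) - u l) - z) ^+ 2 <=
  norm (u l - z) ^+ 2 -
    lambda l * (2 - lambda l) / 4 * norm (T (u l) - u l) ^+ 2.
Proof.
have /andP[l0 l2] := lambda02 l.
have -> : u l + (lambda l / 2) *: (T (u l) - u l) - z =
    (u l - z) + (lambda l / 2) *: ((T (u l) - z) - (u l - z)).
  by rewrite opprB addrA subrK addrAC.
have := T_nonexp (u l) z; rewrite Tz.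
rewrite (dnorm_le ip) !(sqr_dnorm ip) dot_relaxation.
have -> : T (u l) - z - (u l - z) = T (u l) - u l.
  by rewrite opprB addrA subrK.
set a := '[u l - z, _]; set b := '[T (u l) - z, _]; set d := '[T _ - u l, _].
move=> ba; have : 0 <= lambda l / 2 * (a - b).
  by rewrite mulr_ge0 ?divr_ge0 ?subr_ge0 // ltW.
lra.
Qed.

Lemma relaxation_nonexpansive l :
  norm (u l + (lambda l / 2) *: (T (u l) - u l) - z) <= norm (u l - z).
Proof.
have /andP[l0 l2] := lambda02 l.
rewrite -(@ler_pXn2r _ 2) ?nnegrE ?dnorm_ge0 //.
apply: le_trans (relaxation_descent l) _; rewrite gerBl.
by rewrite mulr_ge0 ?sqr_ge0 // divr_ge0.
Qed.

Let step_le l : norm (u l.+1 - z) <=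
  norm (u l + (lambda l / 2) *: (T (u l) - u l) - z) + eps l.
Proof.
have /andP[l0 _] := lambda02 l.
rewrite uS addrAC; apply: le_trans (ler_dnormD ip _ _) _.
by rewrite (dnormZ ip (lambda l)) gtr0_norm.
Qed.

(** Exact steps never move away from a fixed point, so that only the errors can
    increase the distance to it. *)
Lemma quasi_fejer k n : (k <= n)%N ->
  norm (u n - z) <= norm (u k - z) + \sum_(k <= l < n) eps l.
Proof.
elim: n => [|n IHn]; first by rewrite leqn0 => /eqP->; rewrite big_geq ?addr0.
rewrite leq_eqVlt => /predU1P[->|]; first by rewrite big_geq ?addr0.
rewrite ltnS => kn; rewrite big_nat_recr //= addrA.
apply: le_trans (step_le n) _; rewrite lerD2r.
exact: le_trans (relaxation_nonexpansive n) (IHn kn).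
Qed.

Lemma quasi_fejer_bounded n : norm (u n - z) <= norm (u 0 - z) + B.
Proof. by apply: le_trans (quasi_fejer (leq0n n)) _; rewrite lerD2l. Qed.

(** The descent inequality telescopes. With [M] a bound of the distances to [z],
    an error [eps l] increases a squared distance by at most twice [M * eps l]
    plus [eps l ^ 2], and [eps l <= B]. *)
Lemma residual_sum n :
  \sum_(0 <= l < n)
    lambda l * (2 - lambda l) / 4 * norm (T (u l) - u l) ^+ 2 <=
  norm (u 0 - z) ^+ 2 + (2 * (norm (u 0 - z) + B) + B) * B.
Proof.
set M := norm (u 0 - z) + B.
have M_ge0 : 0 <= M by rewrite addr_ge0 ?dnorm_ge0.
suff : norm (u n - z) ^+ 2 + \sum_(0 <= l < n)
    lambda l * (2 - lambda l) / 4 * norm (T (u l) - u l) ^+ 2 <=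
    norm (u 0 - z) ^+ 2 + (2 * M + B) * \sum_(0 <= l < n) eps l.
  have := sqr_ge0 (norm (u n - z)).
  have : (2 * M + B) * \sum_(0 <= l < n) eps l <= (2 * M + B) * B.
    by rewrite ler_wpM2l // addr_ge0 // mulr_ge0.
  lra.
elim: n => [|n IHn]; first by rewrite !big_geq // mulr0.
rewrite !big_nat_recr //=.
have := relaxation_descent n; have := relaxation_nonexpansive n.
have := quasi_fejer_bounded n; have := step_le n.
have := dnorm_ge0 (dot := dot) (u n.+1 - z).
have := dnorm_ge0 (dot := dot)
  (u n + (lambda n / 2) *: (T (u n) - u n) - z).
move: IHn (eps_ge0 n) (eps_le n) => /=; rewrite -/M.
set e := lambda n * norm (c n); set a := norm (_ + _ - z).
set b := norm (u n.+1 - z); set d := norm (u n - z).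
set r := _ / 4 * _; set s := \sum_(_ <= _ < _) _; set s' := \sum_(_ <= _ < _) _.
move=> IHn e0 eB a0 b0 ba dM ad ar.
have : b ^+ 2 <= (a + e) ^+ 2 by rewrite ler_pXn2r // nnegrE addr_ge0.
have : a * e <= M * e by rewrite ler_wpM2r // (le_trans ad).
have : e * e <= B * e by rewrite ler_wpM2r.
lra.
Qed.

End FixedPoint.

Context (lambda_sum : forall D : R,
  exists n, D < \sum_(0 <= l < n) lambda l * (2 - lambda l)).

(** The residual cannot stay away from 0: the sum of the weighted squared
    residuals is finite while the sum of the weights is infinite. *)
Lemma residual_small z : T z = z -> forall (e : R) k, 0 < e ->
  exists2 l, (k <= l)%N & norm (T (u l) - u l) < e.
Proof.
move=> Tz e k e_gt0; apply: contrapT => no_l.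
have res_ge l : (k <= l)%N -> e <= norm (T (u l) - u l).
  by move=> kl; rewrite leNgt; apply/negP => lt_e; apply: no_l; exists l.
have := residual_sum Tz; set C := (X in _ -> X) => {no_l}.
pose C0 := norm (u 0 - z) ^+ 2 + (2 * (norm (u 0 - z) + B) + B) * B.
have [n] := lambda_sum (4 * C0 / e ^+ 2 +
  \sum_(0 <= l < k) lambda l * (2 - lambda l)).
move=> lt_n res_sum; have := res_sum (maxn k n).
rewrite leNgt => /negP; apply.
have {lt_n} : 4 * C0 / e ^+ 2 <
    \sum_(k <= l < maxn k n) lambda l * (2 - lambda l).
  rewrite -(ltrD2r (\sum_(0 <= l < k) lambda l * (2 - lambda l))).
  apply: lt_le_trans lt_n _; rewrite addrC -big_cat_nat ?leq_maxl //=.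
  by rewrite [leRHS](@big_cat_nat _ _ _ n) ?leq_maxr //= lerDl sumr_ge0.
rewrite ltr_pdivrMr ?exprn_gt0 // -/C0 => lt_C0.
rewrite (@big_cat_nat _ _ _ k) ?leq_maxl //=.
apply: lt_le_trans (_ : (\sum_(k <= l < maxn k n) lambda l * (2 - lambda l)) *
  e ^+ 2 / 4 <= _); first by rewrite ltr_pdivlMr // mulrC.
rewrite -mulrA mulr_suml ler_wpDl //.
  by apply: sumr_ge0 => l _; rewrite mulr_ge0 ?sqr_ge0 // divr_ge0.
apply: ler_sum_nat => l /andP[/res_ge e_le _].
rewrite mulrA mulrAC ler_wpM2l ?divr_ge0 //.
by rewrite ler_pXn2r ?nnegrE ?dnorm_ge0 // ltW.
Qed.

(** In finite dimension the iterates have a cluster point along which the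
    residual vanishes; it is a fixed point, and quasi-Fejer monotonicity with
    respect to it makes the whole sequence converge. *)
Theorem krasnoselskii_mann : bolzano dot -> (exists z, T z = z) ->
  exists2 x, T x = x & forall e : R, 0 < e ->
    exists k, forall l, (k <= l)%N -> norm (u l - x) < e.
Proof.
move=> bw [z Tz].
have n1_gt0 (n : nat) : 0 < n.+1%:R^-1 :> R by rewrite invr_gt0 ltr0Sn.
have /choice[s sP] (n : nat) : exists l,
    (n <= l)%N /\ norm (T (u l) - u l) < n.+1%:R^-1.
  by have [l nl ul] := residual_small Tz n (n1_gt0 n); exists l.
have [|x x_cluster] := bw (u \o s) (norm (u 0 - z) + B + norm z).
  move=> l /=; rewrite -{1}(subrK z (u (s l))).
  apply: le_trans (ler_dnormD ip _ _) _; rewrite lerD2r.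
  exact: quasi_fejer_bounded.
have Tx : T x = x.
  apply/eqP; rewrite -subr_eq0; apply/eqP/(dnorm_eq0 ip)/eqP.
  rewrite eq_le dnorm_ge0 andbT; apply/ler_addgt0Pr => e e_gt0; rewrite add0r.
  have [|k] := @ltr_add_invr R 0 (e / 2); first by rewrite divr_gt0.
  rewrite add0r => ke.
  have [|l kl /= ul] := x_cluster (e / 4) k; first by rewrite divr_gt0.
  have -> : T x - x = (T x - T (u (s l))) + (T (u (s l)) - u (s l))
                      + (u (s l) - x) by rewrite !addrA !subrK.
  apply: le_trans (ler_dnormD ip _ _) _.
  have := ler_dnormD ip (T x - T (u (s l))) (T (u (s l)) - u (s l)).
  have := T_nonexp x (u (s l)); rewrite (dnormB ip x).
  have [_] := sP l; have : l.+1%:R^-1 <= k.+1%:R^-1 :> R.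
    by rewrite lef_pV2 ?posrE ?ltr0Sn // ler_nat.
  by move: ke; set il := l.+1%:R^-1; set ik := k.+1%:R^-1; lra.
exists x => // e e_gt0.
pose sums := [set \sum_(0 <= l < n) eps l | n in [set: nat]].
have sums_sup : has_sup sums.
  by split; [exists 0, 0%N; rewrite ?big_geq | exists B => _ [n _ <-]].
have [|_ [k _ <-] lt_k] := @sup_adherent _ sums (e / 2) _ sums_sup.
  by rewrite divr_gt0.
have [|l kl /= ul] := x_cluster (e / 2) k; first by rewrite divr_gt0.
have [s_ge _] := sP l.
exists (s l) => n sn; apply: le_lt_trans (quasi_fejer Tx sn) _.
have ks : (k <= s l)%N by exact: leq_trans kl s_ge.
have : \sum_(0 <= l < n) eps l <= sup sums.
  by apply: ub_le_sup; [case: sums_sup | exists n].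
rewrite (@big_cat_nat _ _ _ (s l)) //= (@big_cat_nat _ _ _ k) //=.
have : 0 <= \sum_(k <= l < s l) eps l by apply: sumr_ge0.
lra.
Qed.

End KrasnoselskiiMann.

(** * Linear minorants of convex sets *)

Section LinearMinorant.
Context {R : realType} {m n : nat}.
Implicit Types (L v w : 'M[R]_(m, n)).
Local Notation mdot := (@wdot R m n (fun=> 1)).

Let mdot_ip : inner_product mdot.
Proof. by apply: wdot_inner_product => j; exact: ltr01. Qed.

Lemma mdot_delta v i j : mdot (delta_mx i j) v = v i j.
Proof.
rewrite /wdot (bigD1 j) //= /edot (bigD1 i) //= !mxE !eqxx !mul1r.
rewrite big1 => [|k ki]; last by rewrite !mxE (negPf ki) mul0r.
rewrite addr0 big1 ?addr0 // => k kj; rewrite big1 ?mulr0 // => l _.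
by rewrite !mxE (negPf kj) andbF mul0r.
Qed.

Context (E : 'M[R]_(m, n) -> R -> Prop).
Context (E_convex : forall t v a w b, 0 < t < 1 -> E v a -> E w b ->
  E (t *: v + (1 - t) *: w) (t * a + (1 - t) * b)).
Context (E_sym : forall v a, E v a -> exists e b, 0 < e /\ E (- e *: v) b).
Context (E_ge0 : forall a, E 0 a -> 0 <= a).

Let supported (s : seq ('I_m * 'I_n)) v :=
  forall i j, (i, j) \notin s -> v i j = 0.

(** Induction on the list of entries that may be nonzero. For a new entry, the
    coefficient added to [L] is the supremum of the slopes at the points of [E]
    where this entry is negative. These slopes are at most those at the points
    where it is positive: two such points have a convex combination at which the
    entry vanishes, and there the induction hypothesis applies. *)
Lemma linear_minorant_seq s :
  exists L, forall v a, supported s v -> E v a -> mdot L v <= a.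
Proof.
elim: s => [|[i j] s [L L_le]].
  exists 0 => v a v0 Ea; rewrite (dot0l mdot_ip); apply: E_ge0.
  by have <- : v = 0 by apply/matrixP => i j; rewrite mxE v0.
pose slope v a := (a - mdot L v) / v i j.
pose neg := [set r | exists v a,
  [/\ supported ((i, j) :: s) v, E v a, v i j < 0 & r = slope v a]].
have slope_le v a w b : supported ((i, j) :: s) v -> E v a -> v i j < 0 ->
    supported ((i, j) :: s) w -> E w b -> 0 < w i j ->
    slope v a <= slope w b.
  move=> sv Eva v_lt0 sw Ewb w_gt0.
  set p := - v i j; have p_gt0 : 0 < p by rewrite oppr_gt0.
  have q_gt0 : 0 < p + w i j by rewrite addr_gt0.
  (* These weights cancel the (i, j) entries. *)
  pose t := w i j / (p + w i j).
  have t01 : 0 < t < 1 by rewrite divr_gt0 //= ltr_pdivrMr // mul1r ltrDr.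
  have tE : 1 - t = p / (p + w i j).
    by rewrite /t -{1}(divff (lt0r_neq0 q_gt0)) -mulrBl addrK.
  have svw : supported s (t *: v + (1 - t) *: w).
    move=> k l kl; rewrite !mxE tE /t.
    have [[-> ->]|ne] := eqVneq (k, l) (i, j).
      by rewrite /p; ring.
    have nin : (k, l) \notin (i, j) :: s by rewrite inE negb_or ne.
    by rewrite (sv _ _ nin) (sw _ _ nin) !mulr0 addr0.
  have := L_le _ _ svw (E_convex t01 Eva Ewb).
  rewrite !(dotE mdot_ip) tE /t /slope => h.
  have {}h : w i j * mdot L v + p * mdot L w <= w i j * a + p * b.
    move: h; rewrite ![_ / _ * _]mulrAC -!mulrDl ler_pM2r ?invr_gt0 //.
  rewrite -[v i j]opprK -/p invrN mulrN -mulNr ler_pdivrMr // mulrAC.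
  rewrite ler_pdivlMr //; lra.
pose c := sup neg; exists (L + c *: delta_mx i j) => v a sv Eva.
have symE w b : supported ((i, j) :: s) w -> E w b ->
    exists e b', [/\ 0 < e, supported ((i, j) :: s) (- e *: w)
                & E (- e *: w) b'].
  move=> sw Ewb; have [e [b' [e_gt0 Eb']]] := E_sym Ewb.
  by exists e, b'; split=> // k l kl; rewrite mxE sw ?mulr0.
rewrite !(dotE mdot_ip) mdot_delta -lerBrDl.
have [v_lt0|v_gt0|v0] := ltgtP (v i j) 0.
- rewrite -ler_ndivrMr //; apply: ub_le_sup; last by exists v, a.
  have [e [b [e_gt0 sw Ewb]]] := symE _ _ sv Eva.
  exists (slope (- e *: v) b) => _ [w [b' [sw' Ew' w_lt0 ->]]].
  by apply: slope_le => //; rewrite mxE nmulr_lgt0 ?oppr_lt0.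
- rewrite -ler_pdivlMr //; apply: sup_le_ub.
    have [e [b [e_gt0 sw Ewb]]] := symE _ _ sv Eva.
    exists (slope (- e *: v) b), (- e *: v), b; split=> //.
    by rewrite mxE pmulr_llt0 ?oppr_lt0.
  by move=> _ [w [b' [sw' Ew' w_lt0 ->]]]; exact: slope_le.
- rewrite v0 mulr0 subr_ge0; apply: L_le => // k l kl.
  have [[-> ->]//|ne] := eqVneq (k, l) (i, j).
  by apply: sv; rewrite inE negb_or ne.
Qed.

(** Finite-dimensional Hahn-Banach theorem in epigraph form. The symmetry of the
    domain of [E] says that 0 is in its relative interior; it makes every
    one-dimensional extension step possible. *)
Lemma linear_minorant : exists L, forall v a, E v a -> mdot L v <= a.
Proof.
have [L L_le] := linear_minorant_seq (enum {: 'I_m * 'I_n}).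
by exists L => v a; apply: L_le => i j; rewrite mem_enum.
Qed.

End LinearMinorant.

(** * Subgradients *)

Section Subgradients.
Context {R : realType} {n : nat}.
Implicit Types (phi : 'cV[R]_n -> \bar R) (C : set 'cV[R]_n).
Implicit Types (x y z s : 'cV[R]_n).

Definition subgrad phi x s :=
  phi x \is a fin_num /\ forall y, (phi x + (edot s (y - x))%:E <= phi y)%E.

(** Algebraic form of the relative interior: every segment from a point of [C]
    to [z] can be prolonged beyond [z] inside [C]. *)
Definition rel_core C z :=
  C z /\ forall y, C y -> \forall e \near 0^'+, C (z - e *: (y - z)).

(** The prolonged segment stays in the affine hull of [C], and it is near [z]
    for small [e]. *)
Lemma rint_rel_core C z : rint C z -> rel_core C z.
Proof.
move=> [z_hull z_near]; split; first exact: (nbhs_singleton z_near).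
move=> y Cy; pose p (e : R) := z - e *: (y - z).
have p_hull e : affine_hull C (p e).
  move=> A [A_affine CA].
  have -> : p e = - e *: y + (1 - - e) *: z.
    by rewrite /p scalerBr opprB scaleNr opprK scalerDl scale1r addrA addrC.
  by apply: (A_affine); [exact: CA | exact: (z_hull A (conj A_affine CA))].
have p_cvg : p e @[e --> 0^'+] --> z.
  apply: cvg_at_right_filter; rewrite -[X in _ --> X](subr0 z).
  apply: cvgB; first exact: cvg_cst.
  by rewrite -(scale0r (y - z)); apply: cvgZr_tmp; exact: cvg_id.
have : \forall e \near 0^'+, affine_hull C (p e) -> C (p e).
  exact: (p_cvg _ z_near).
by apply: filterS => e p_in; exact: (p_in (p_hull e)).
Qed.

Lemma econvex_le phi x y (a b t : R) : econvex phi -> 0 < t < 1 ->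
  (phi x <= a%:E)%E -> (phi y <= b%:E)%E ->
  (phi (t *: x + (1 - t) *: y)%R <= (t * a + (1 - t) * b)%R%:E)%E.
Proof.
move=> phi_convex t01 xa yb; apply: le_trans (phi_convex x y t t01) _.
have /andP[t0 t1] := t01; rewrite [leRHS]EFinD !EFinM.
by apply: leeD; apply: lee_wpmul2l => //; rewrite lee_fin ?subr_ge0 ltW.
Qed.

(** [E] is the epigraph of [phi] translated so that (z, phi z) becomes the
    origin. *)
Lemma rel_core_subgrad phi z : (forall x, phi x != -oo%E) -> econvex phi ->
  rel_core (edom phi) z -> exists s, subgrad phi z s.
Proof.
move=> phi_nNy phi_convex [z_dom z_core].
have z_fin : phi z \is a fin_num by rewrite fin_numE phi_nNy lt_eqF.
pose E v (a : R) := (phi (z + v)%R <= (a + fine (phi z))%R%:E)%E.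
have [|||s s_le] := @linear_minorant R n 1 E.
- move=> t v a w b t01 Ev Ew; rewrite /E.
  have -> : z + (t *: v + (1 - t) *: w) = t *: (z + v) + (1 - t) *: (z + w).
    by rewrite !scalerDr addrACA -scalerDl [t + _]addrC subrK scale1r.
  have -> : t * a + (1 - t) * b + fine (phi z) =
    t * (a + fine (phi z)) + (1 - t) * (b + fine (phi z)) by ring.
  exact: econvex_le.
- move=> v a Ev.
  have v_dom : edom phi (z + v) by apply: le_lt_trans Ev (ltry _).
  have := z_core _ v_dom; rewrite addrAC subrr add0r => v_near.
  have [e [e_gt0 e_dom]] := filter_ex (filterI (nbhs_right_gt 0) v_near).
  exists e, (fine (phi (z - e *: v)) - fine (phi z)); split=> //.
  rewrite /E subrK scaleNr fineK //.
  by rewrite fin_numE phi_nNy lt_eqF.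
- by move=> a; rewrite /E addr0 -{1}(fineK z_fin) lee_fin lerDr.
exists s; split=> // y.
have [y_fin|] := boolP (phi y \is a fin_num); last first.
  by rewrite fin_numE phi_nNy /= negbK => /eqP ->; exact: leey.
have := s_le (y - z) (fine (phi y) - fine (phi z)).
rewrite /E addrC subrK subrK fineK // => /(_ (lexx _)).
rewrite /wdot big_ord1 mul1r => h.
rewrite -(fineK z_fin) -(fineK y_fin) -EFinD lee_fin -lerBrDl.
apply: le_trans _ h; rewrite le_eqVlt; apply/orP; left; apply/eqP.
by apply: eq_bigr => i _; rewrite !mxE.
Qed.

Lemma subgrad_monotone phi x y s t :
  subgrad phi x s -> subgrad phi y t -> 0 <= edot (s - t) (x - y).
Proof.
have ip := @edot_inner_product R n.
move=> [x_fin sP] [y_fin tP]; have := sP y; have := tP x.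
rewrite -(fineK x_fin) -(fineK y_fin) -!EFinD !lee_fin !(dotE ip); lra.
Qed.

End Subgradients.

Section SumRule.
Context {R : realType} {n J : nat} (h : 'I_J -> 'cV[R]_n -> \bar R).
Context (h_nNy : forall j x, h j x != -oo%E).

Lemma sum_lt_pinfty x :
  (\sum_j h j x < +oo)%E -> forall j, h j x \is a fin_num.
Proof.
move=> sum_lt j; rewrite fin_numE h_nNy /=; apply/eqP => hjx.
have /negbT := lt_eqF sum_lt; rewrite esum_eqy // => /negP; apply.
by apply/existsP; exists j; rewrite hjx.
Qed.

Context (h_convex : forall j, econvex (h j)).

(** Fermat's rule for a sum, with the subgradient split among the terms. The set
    [E] is the epigraph of the perturbation function w |-> inf over x of sum_j
    h_j (x + w_j) - min, whose domain has 0 in its relative interior by the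
    qualification condition; the columns of a linear minorant are the required
    subgradients, and invariance of the perturbation under a common translation
    of the w_j forces their sum to vanish. *)
Theorem fermat_sum_rule z xhat : (forall j, rel_core (edom (h j)) z) ->
  Argmin (fun x => \sum_j h j x)%E xhat ->
  exists2 s : 'I_J -> 'cV[R]_n,
    forall j, subgrad (h j) xhat (s j) & \sum_j s j = 0.
Proof.
move=> z_core xhat_min; have ip := @edot_inner_product R n.
have xhat_fin j : h j xhat \is a fin_num.
  apply: sum_lt_pinfty; apply: le_lt_trans (xhat_min z) _.
  by apply: lte_sum_pinfty => i _; case: (z_core i).
pose m j := fine (h j xhat).
have hm j : h j xhat = (m j)%:E by rewrite fineK.
pose E (w : 'M[R]_(n, J)) (a : R) := exists x (t : 'I_J -> R),
  (forall j, h j (x + col j w)%R <= (t j)%:E)%E /\ a = \sum_j t j - \sum_j m j.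
have [|||L L_le] := @linear_minorant R n J E.
- move=> t v a w b t01 [x [ta [xta ->]]] [y [tb [ytb ->]]].
  exists (t *: x + (1 - t) *: y), (fun j => t * ta j + (1 - t) * tb j).
  split; last by rewrite big_split -!mulr_sumr /=; ring.
  move=> j; rewrite linearD !linearZ /= addrACA -!scalerDr.
  exact: econvex_le.
- move=> w a [x [t [xt _]]].
  have w_near : \forall e \near 0^'+,
      forall j, edom (h j) (z - e *: (x + col j w - z)).
    apply: filter_forall => j; have [_] := z_core j; apply.
    exact: le_lt_trans (xt j) (ltry _).
  have [e [e_gt0 e_dom]] := filter_ex (filterI (nbhs_right_gt 0) w_near).
  pose y := z - e *: (x - z); pose tau j := fine (h j (y + col j (- e *: w))).
  exists e, (\sum_j tau j - \sum_j m j); split=> //.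
  exists y, tau; split=> // j.
  have yE : y + col j (- e *: w) = z - e *: (x + col j w - z).
    have -> : col j (- e *: w) = - (e *: col j w).
      by apply/colP => i; rewrite !mxE mulNr.
    by rewrite /y -addrA -opprD -scalerDr [x - z + _]addrAC.
  by rewrite /tau fineK // yE fin_numE h_nNy lt_eqF //; exact: e_dom.
- move=> a [x [t [xt ->]]]; rewrite subr_ge0 -lee_fin -!sumEFin.
  rewrite (eq_bigr (fun j => h j xhat)) => [|j _]; last by rewrite hm.
  apply: le_trans (xhat_min x) _; apply: lee_sum => j _.
  by have := xt j; rewrite col0 addr0.
exists (fun j => col j L).
  move=> j; split=> // y.
  have [hy|] := boolP (h j y \is a fin_num); last first.
    by rewrite fin_numE h_nNy /= negbK => /eqP ->; exact: leey.
  pose w : 'M[R]_(n, J) := \matrix_(i, k) ((y - xhat) i 0 *+ (k == j)).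
  have col_w k : col k w = if k == j then y - xhat else 0.
    by apply/colP => i; rewrite !mxE; case: eqP => _; rewrite !mxE ?mulr0n.
  pose t k := if k == j then fine (h j y) else m k.
  have /L_le : E w (\sum_k t k - \sum_k m k).
    exists xhat, t; split=> // k; rewrite col_w /t; case: eqP => [->|_].
      by rewrite addrC subrK fineK.
    by rewrite addr0 hm.
  rewrite (bigD1 j) //= [\sum_k m k](bigD1 j) //= {1}/t eqxx.
  rewrite (eq_bigr m) => [|k kj]; last by rewrite /t (negPf kj).
  rewrite opprD addrACA subrr addr0 => h_le.
  rewrite hm -(fineK hy) -EFinD lee_fin -lerBrDl; apply: le_trans h_le.
  rewrite /wdot (bigD1 j) //= col_w eqxx mul1r big1 ?addr0 // => k kj.
  by rewrite col_w (negPf kj) mul1r ip.(dotC) (dot0l ip).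
set S := \sum_j _; apply: (ip.(dot_eq0)); apply/eqP; rewrite eq_le.
rewrite ip.(dot_ge0) andbT.
(* All the terms are translated by S, which the point xhat - S undoes. *)
have /L_le : E (\matrix_(i, j) S i 0) 0.
  exists (xhat - S), m; split; last by rewrite subrr.
  move=> j; rewrite (_ : col j _ = S) ?subrK ?hm //.
  by apply/colP => i; rewrite !mxE.
apply: le_trans; rewrite {1}/S /wdot le_eqVlt; apply/orP; left; apply/eqP.
rewrite (big_morph (fun v => edot v S)
  (fun x y => ip.(dotDl) x y S) (dot0l ip S)).
apply: eq_bigr => j _; rewrite mul1r; congr edot.
by apply/colP => i; rewrite !mxE.
Qed.

Lemma subgrad_sum_Argmin x (s : 'I_J -> 'cV[R]_n) :
  (forall j, subgrad (h j) x (s j)) -> \sum_j s j = 0 ->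
  Argmin (fun x => \sum_j h j x)%E x.
Proof.
have ip := @edot_inner_product R n.
move=> sP s0 y; have -> : (\sum_j h j x =
    \sum_j (h j x + (edot (s j) (y - x))%:E))%E.
  rewrite big_split /= sumEFin.
  rewrite -(big_morph (fun v => edot v (y - x))
    (fun a b => ip.(dotDl) a b (y - x)) (dot0l ip (y - x))).
  by rewrite s0 (dot0l ip) adde0.
by apply: lee_sum => j _; have [_] := sP j; apply.
Qed.

End SumRule.

(** * Existence of minimizers and proximal points *)

Section Semicontinuity.
Context {R : realType}.

(** Lower semicontinuity with Euclidean balls as neighbourhoods, to match the
    norm of the coercivity condition and of the proximal objective. *)
Definition elsc (n : nat) (phi : 'cV[R]_n -> \bar R) :=
  forall x a, (a%:E < phi x)%E -> exists2 d : R, 0 < d &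
    forall y, enorm (y - x) < d -> (a%:E < phi y)%E.

Lemma lower_semicontinuous_elsc n (phi : 'cV[R]_n -> \bar R) :
  lower_semicontinuous phi -> elsc phi.
Proof.
move=> phi_lsc x a /phi_lsc[V /nbhs_ballP[d /= d_gt0 dV] V_gt].
exists d => // y yx; apply/V_gt/dV.
rewrite -ball_normE /= distrC; exact: le_lt_trans (ler_mx_norm_enorm _) yx.
Qed.

Lemma elscD n (phi psi : 'cV[R]_n -> \bar R) :
  (forall x, phi x != -oo%E) -> (forall x, psi x != -oo%E) ->
  elsc phi -> elsc psi -> elsc (fun x => phi x + psi x)%E.
Proof.
move=> phi_nNy psi_nNy phi_lsc psi_lsc x a a_lt.
have [[b c] /= [b_lt c_lt a_le]] : exists bc : R * R,
    [/\ (bc.1%:E < phi x)%E, (bc.2%:E < psi x)%E & a <= bc.1 + bc.2].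
  move: (phi_nNy x) (psi_nNy x) a_lt.
  case: (phi x) => [r| |] //; case: (psi x) => [s| |] // _ _.
  - rewrite -EFinD lte_fin => a_lt.
    exists (r - (r + s - a) / 2, s - (r + s - a) / 2) => /=.
    by rewrite !lte_fin; split; lra.
  - by exists (r - 1, a - r + 1) => /=; rewrite lte_fin ltry; split => //; lra.
  - by exists (a - s + 1, s - 1) => /=; rewrite lte_fin ltry; split => //; lra.
  - by exists (a, 0) => /=; rewrite !ltry addr0.
have [d d_gt0 dP] := phi_lsc _ _ b_lt; have [e e_gt0 eP] := psi_lsc _ _ c_lt.
exists (Num.min d e) => [|y]; first by rewrite lt_min d_gt0.
rewrite lt_min => /andP[/dP b_lt' /eP c_lt'].
apply: le_lt_trans (_ : (b%:E + c%:E < _)%E); first by rewrite -EFinD lee_fin.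
exact: lteD.
Qed.

Lemma elsc_sum n J (h : 'I_J -> 'cV[R]_n -> \bar R) :
  (forall j x, h j x != -oo%E) -> (forall j, elsc (h j)) ->
  elsc (fun x => \sum_j h j x)%E.
Proof.
move=> h_nNy h_lsc.
have sum_nNy (s : seq 'I_J) x : (\sum_(j <- s) h j x != -oo)%E.
  by apply/eqP => /esum_eqNyP[j [_ _ hj]]; have := h_nNy j x; rewrite hj.
rewrite /index_enum; elim: (Finite.enum _) => [|j s IHs].
  by move=> x a; rewrite big_nil => a_lt; exists 1 => // y _; rewrite big_nil.
have := elscD (h_nNy j) (sum_nNy s) (h_lsc j) IHs.
by congr elsc; apply/funext => x; rewrite big_cons.
Qed.

Lemma ler_enorm_mulmx m n (A : 'M[R]_(m, n)) x :
  enorm (A *m x) <= (\sum_i \sum_j `|A i j|) * enorm x.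
Proof.
apply: le_trans (ler_enorm_sum _) _; rewrite mulr_suml; apply: ler_sum => i _.
rewrite mxE mulr_suml; apply: le_trans (ler_norm_sum _ _ _) _.
by apply: ler_sum => j _; rewrite normrM ler_wpM2l // ler_coord_enorm.
Qed.

Lemma elsc_mulmx m n (A : 'M[R]_(m, n)) (phi : 'cV[R]_m -> \bar R) :
  elsc phi -> elsc (fun x => phi (A *m x)).
Proof.
move=> phi_lsc x a /phi_lsc[d d_gt0 dP].
pose C := \sum_i \sum_j `|A i j|.
have C1_gt0 : 0 < C + 1.
  by rewrite ltr_wpDl // /C sumr_ge0 // => i _; exact: sumr_ge0.
exists (d / (C + 1)) => [|y yx]; first exact: divr_gt0.
apply: dP; rewrite -mulmxBr; apply: le_lt_trans (ler_enorm_mulmx _ _) _.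
apply: le_lt_trans (_ : (C + 1) * enorm (y - x) < _).
  by rewrite ler_wpM2r ?sqrtr_ge0 // lerDl.
by rewrite mulrC -ltr_pdivlMr.
Qed.

Context {n : nat}.
Implicit Types (phi : 'cV[R]_n -> \bar R) (x u v y z : 'cV[R]_n).
Let ip := @edot_inner_product R n.

(** Existence step of the direct method: [b] stands for a sequence of reals
    decreasing to the infimum, be it finite or not, and [v] for a minimizing
    sequence; the point obtained is a cluster point of [v]. *)
Lemma coercive_below phi (b : nat -> R) (v : nat -> 'cV[R]_n) :
  elsc phi -> coercive phi -> nonincreasing_seq b ->
  (forall k, (phi (v k) <= (b k)%:E)%E) ->
  exists x, forall k, (phi x <= (b k)%:E)%E.
Proof.
move=> phi_lsc phi_coercive b_noninc v_le.
have [r r_lt] := phi_coercive (b 0).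
have [l|x x_cluster] := @bolzano_edot R n v r.
  rewrite -enormE leNgt; apply/negP => /r_lt; apply/negP; rewrite -leNgt.
  by apply: le_trans (v_le l) _; rewrite lee_fin b_noninc.
exists x => k; rewrite leNgt; apply/negP => /phi_lsc[d d_gt0 dP].
have [l kl] := x_cluster d k d_gt0; rewrite -enormE => /dP.
apply/negP; rewrite -leNgt; apply: le_trans (v_le l) _.
by rewrite lee_fin b_noninc.
Qed.

Theorem elsc_coercive_Argmin phi : (forall x, phi x != -oo%E) ->
  elsc phi -> coercive phi -> exists x, Argmin phi x.
Proof.
move=> phi_nNy phi_lsc phi_coercive.
have inf_le x : (ereal_inf (range phi) <= phi x)%E.
  by apply: ereal_inf_lbound; exists x.
case inf_phi : (ereal_inf (range phi)) => [m| |].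
- have /choice[v v_le] (k : nat) :
      exists v, (phi v <= (m + k.+1%:R^-1)%:E)%E.
    have m_fin : ereal_inf (range phi) \is a fin_num by rewrite inf_phi.
    have k_gt0 : 0 < k.+1%:R^-1 :> R by rewrite invr_gt0.
    have [_ [v _ <-]] := lb_ereal_inf_adherent k_gt0 m_fin.
    by rewrite inf_phi -EFinD => /ltW; exists v.
  have [|x x_le] := coercive_below phi_lsc phi_coercive _ v_le.
    by move=> k l kl; rewrite lerD2l lef_pV2 ?posrE // ler_nat.
  exists x => y; apply: le_trans (_ : m%:E <= _)%E; last by rewrite -inf_phi.
  have x_fin : phi x \is a fin_num.
    by rewrite fin_numE phi_nNy lt_eqF // (le_lt_trans (x_le 0%N)) ?ltry.
  rewrite -(fineK x_fin) lee_fin leNgt; apply/negP => /ltr_add_invr[k].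
  by rewrite ltNge -lee_fin fineK // x_le.
- exists 0 => y; have := inf_le y.
  by rewrite inf_phi leye_eq => /eqP ->; exact: leey.
have /choice[v v_le] (k : nat) : exists v, (phi v <= (- k%:R)%:E)%E.
  have : (ereal_inf (range phi) < (- k%:R)%:E)%E by rewrite inf_phi ltNyr.
  by move=> /ereal_inf_lt[_ [v _ <-]] /ltW; exists v.
have [|x x_le] := coercive_below phi_lsc phi_coercive _ v_le.
  by move=> k l kl; rewrite lerN2 ler_nat.
have x_fin : phi x \is a fin_num.
  by rewrite fin_numE phi_nNy lt_eqF // (le_lt_trans (x_le 0%N)) ?ltry.
have [k] : exists k : nat, - fine (phi x) < k%:R.
  by exists (Num.truncn `|fine (phi x)|).+1;
    rewrite (le_lt_trans _ (truncnS_gt _)) // -normrN ler_norm.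
by rewrite ltrNl ltNge -lee_fin fineK // x_le.
Qed.

(** The squared distance lies above its tangent plane at [x], whose slope is
    [enorm (x - u)]. *)
Lemma elsc_sqr_dist u : elsc (fun v => (2^-1 * enorm (v - u) ^+ 2)%:E).
Proof.
move=> x a; rewrite lte_fin => a_lt; set q := (X in a < X) in a_lt.
pose d := (q - a) / (enorm (x - u) + 1).
have e_ge0 y : 0 <= enorm y by exact: sqrtr_ge0.
have e1_gt0 : 0 < enorm (x - u) + 1 by rewrite ltr_wpDl.
exists d => [|y yx]; first by rewrite divr_gt0 // subr_gt0.
have d_gt0 : 0 < d by apply: le_lt_trans yx.
rewrite lte_fin.
have -> : y - u = (x - u) + (y - x) by rewrite [RHS]addrC addrA subrK.
have := cauchy_schwarz ip (- (x - u)) (y - x).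
rewrite (dnormN ip) (dotNl ip) -enormE => cs.
have : enorm (x - u) * enorm (y - x) <= enorm (x - u) * d.
  by rewrite ler_wpM2l // ltW.
have : d * (enorm (x - u) + 1) = q - a by rewrite divfK // gt_eqF.
have := sqr_ge0 (enorm (y - x)).
move: cs; rewrite /q !enormE (sqr_dnormD ip (x - u)); lra.
Qed.

Lemma elscZ (c : R) phi : 0 < c -> elsc phi -> elsc (fun x => c%:E * phi x)%E.
Proof.
move=> c_gt0 phi_lsc x a; rewrite -lte_pdivrMl // => /phi_lsc[d d_gt0 dP].
by exists d => // y /dP; rewrite EFinM lte_pdivrMl.
Qed.

Section Prox.
Context (phi : 'cV[R]_n -> \bar R) (c : R).
Context (phi_Gamma0 : Gamma0 phi) (c_gt0 : 0 < c).

Let Phi u v := ((2^-1 * enorm (v - u) ^+ 2)%:E + c%:E * phi v)%E.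

Let phi_nNy x : phi x != -oo%E.
Proof. by have [[]] := phi_Gamma0. Qed.

Let cphi_nNy x : (c%:E * phi x != -oo)%E.
Proof.
case: (phi x) (phi_nNy x) => [r| |] // _.
by rewrite gt0_muley // lte_fin.
Qed.

Let Phi_nNy u x : Phi u x != -oo%E.
Proof. by rewrite adde_eq_ninfty negb_or /= cphi_nNy. Qed.

(** The quadratic term outgrows the affine minorant given by [s]: at distance
    [t] from [u] the objective is at least [t ^ 2 / 2 - c * enorm s * t], up to
    a constant. *)
Lemma prox_coercive z s u : subgrad phi z s -> coercive (Phi u).
Proof.
move=> [z_fin sP] M; pose b := c * enorm s.
have e_ge0 k (y : 'cV[R]_k) : 0 <= enorm y by exact: sqrtr_ge0.
have b_ge0 : 0 <= b by rewrite mulr_ge0 // ltW.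
pose K := c * (fine (phi z) + edot s (u - z)); pose A : R := `|M - K|.
exists (enorm u + (2 * b + 2) + A) => x x_gt; rewrite /Phi.
have [x_fin|] := boolP (phi x \is a fin_num); last first.
  rewrite fin_numE phi_nNy /= negbK => /eqP ->.
  by rewrite gt0_muley ?lte_fin // addey // ltry.
have := sP x; rewrite -(fineK x_fin) -(fineK z_fin) -EFinM -!EFinD.
rewrite lee_fin lte_fin.
have -> : x - z = (x - u) + (u - z) by rewrite addrA subrK.
rewrite dotDr // => x_ge.
set t := enorm (x - u).
have t_gt : 2 * b + 2 + A < t.
  have : enorm x <= t + enorm u.
    by rewrite -{1}(subrK u x) /t !enormE; exact: (ler_dnormD ip).
  move: x_gt; lra.
have : - (enorm s * t) <= edot s (x - u).
  have := cauchy_schwarz ip (- s) (x - u).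
  by rewrite (dnormN ip) (dotNl ip) -!enormE -/t; lra.
have c_le : c * (fine (phi z) + (edot s (x - u) + edot s (u - z))) <=
    c * fine (phi x) by rewrite ler_pM2l.
move=> cs; have : c * - (enorm s * t) <= c * edot s (x - u) by rewrite ler_pM2l.
have A_ge0 : 0 <= A by rewrite normr_ge0.
have : M - K <= A by exact: ler_norm.
move: c_le; rewrite /K; set c1 := c * _; set c2 := c * - _.
have -> : c2 = - (b * t) by rewrite /c2 /b; ring.
have : 0 <= t * (t - (2 * b + 2)) by rewrite mulr_ge0 //; lra.
rewrite /c1; lra.
Qed.

Lemma nonneg_limit (D N : R) : 0 <= N ->
  (forall t, 0 < t < 1 -> 0 <= D + t * N) -> 0 <= D.
Proof.
move=> N_ge0 DN; rewrite leNgt; apply/negP => D_lt0.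
have q_gt0 : 0 < N + 1 - D by lra.
(* For this r one has D + r N = - r (1 - D), which is negative. *)
pose r := - D / (N + 1 - D).
have r_gt0 : 0 < r by rewrite divr_gt0 ?oppr_gt0.
have /DN : 0 < r < 1 by rewrite r_gt0 ltr_pdivrMr //; lra.
have : r * (N + 1 - D) = - D by rewrite divfK // gt_eqF.
have : r * D < 0 by rewrite pmulr_rlt0.
lra.
Qed.

(** Optimality condition of the proximal problem: compare the minimizer [p] with
    the points of the segment towards [y] and let them tend to [p]. *)
Lemma prox_subgrad z s u : subgrad phi z s ->
  let p := prox (fun v => c%:E * phi v)%E u in
  subgrad phi p (c^-1 *: (u - p)).
Proof.
move=> zs p; have z_fin : phi z \is a fin_num by case: zs.
have [[_ _] phi_lsc phi_convex] := phi_Gamma0.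
have p_min : Argmin (Phi u) p.
  have [||x xP] := @elsc_coercive_Argmin (Phi u) (Phi_nNy u).
  - apply: elscD => //; first exact: elsc_sqr_dist.
    exact/elscZ/lower_semicontinuous_elsc.
  - exact: prox_coercive zs.
  exact: (@xgetPex _ 0 (Argmin (Phi u)) (ex_intro _ x xP)).
have p_fin : phi p \is a fin_num.
  rewrite fin_numE phi_nNy; apply/eqP => phi_p; have := p_min z.
  by rewrite /Phi phi_p gt0_muley ?lte_fin // addey // leye_eq -(fineK z_fin).
split=> // y; have [y_fin|] := boolP (phi y \is a fin_num); last first.
  by rewrite fin_numE phi_nNy /= negbK => /eqP ->; exact: leey.
rewrite -(fineK p_fin) -(fineK y_fin) -EFinD lee_fin.
rewrite -subr_ge0 -(pmulr_rge0 _ c_gt0).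
have cK : c * c^-1 = 1 by rewrite divff ?gt_eqF.
have -> : c * (fine (phi y) -
      (fine (phi p) + edot (c^-1 *: (u - p)) (y - p))) =
    edot (p - u) (y - p) + c * (fine (phi y) - fine (phi p)).
  rewrite -[p - u]opprB (dotNl ip) (dotZl ip) mulrBr mulrDr mulrA cK; ring.
apply: (@nonneg_limit _ (2^-1 * enorm (y - p) ^+ 2)).
  by rewrite mulr_ge0 ?invr_ge0 // sqr_ge0.
move=> t t01; have /andP[t_gt0 t_lt1] := t01.
pose q := t *: y + (1 - t) *: p.
have q_le : (phi q <= (t * fine (phi y) + (1 - t) * fine (phi p))%:E)%E.
  by apply: econvex_le; rewrite ?fineK.
have : (Phi u p <= (2^-1 * enorm (q - u) ^+ 2)%:E +
    c%:E * (t * fine (phi y) + (1 - t) * fine (phi p))%:E)%E.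
  apply: le_trans (p_min q) _; apply: leeD => //.
  by apply: lee_wpmul2l => //; rewrite lee_fin ltW.
rewrite /Phi -{1}(fineK p_fin) -!EFinM -!EFinD lee_fin.
have -> : q - u = (p - u) + t *: (y - p).
  by rewrite /q scalerBl scale1r scalerBr addrCA addrAC.
rewrite !enormE (sqr_dnormD ip (p - u)) (dnormZ ip) (dotZr ip) exprMn.
rewrite gtr0_norm //.
set N := dnorm _ (y - p) ^+ 2; set A := dnorm _ _ ^+ 2; set B := edot _ _.
move=> h; rewrite -(pmulr_rge0 _ t_gt0); lra.
Qed.

End Prox.
End Semicontinuity.

(** * Douglas-Rachford splitting in the product space *)

Section ProductSpace.
Context {R : realType} {n J : nat}.
Context (h : 'I_J -> 'cV[R]_n -> \bar R) (gamma : R) (w : 'I_J -> R).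
Context (gamma_gt0 : 0 < gamma) (w01 : forall j, 0 < w j <= 1).
Context (w_sum : \sum_j w j = 1).
Implicit Types (x y : 'cV[R]_n) (U V : 'M[R]_(n, J)).

Let w_gt0 j : 0 < w j. Proof. by have /andP[] := w01 j. Qed.
Let eip := @edot_inner_product R n.
Let ip := wdot_inner_product n w_gt0.
Local Notation "''[' U , V ]" := (wdot w U V) (format "''[' U ,  V ]").
Local Notation norm := (dnorm (wdot w)).

Definition wavg U : 'cV[R]_n := U *m \col_j w j.
Definition diagonal x : 'M[R]_(n, J) := \matrix_(i, j) x i 0.

Lemma wavgE U : wavg U = \sum_j w j *: col j U.
Proof.
apply/colP => i; rewrite !mxE summxE; apply: eq_bigr => j _.
by rewrite !mxE mulrC.
Qed.

Lemma col_diagonal j x : col j (diagonal x) = x.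
Proof. by apply/colP => i; rewrite !mxE. Qed.

Lemma wavg_diagonal x : wavg (diagonal x) = x.
Proof.
rewrite wavgE (eq_bigr (fun j => w j *: x)) => [|j _].
  by rewrite -scaler_suml w_sum scale1r.
by rewrite col_diagonal.
Qed.

Lemma wdot_diagonal x V : '[diagonal x, V] = edot x (wavg V).
Proof.
rewrite wavgE eip.(dotC) (big_morph (fun v => edot v x)
  (fun a b => eip.(dotDl) a b x) (dot0l eip x)).
apply: eq_bigr => j _.
by rewrite col_diagonal eip.(dotC) eip.(dotZl).
Qed.

Lemma norm_diagonal x : norm (diagonal x) = enorm x.
Proof. by rewrite enormE /dnorm wdot_diagonal wavg_diagonal. Qed.

Lemma ler_enorm_wavg V : enorm (wavg V) <= norm V.
Proof.
have [->|V_neq0] := eqVneq (enorm (wavg V)) 0; first exact: dnorm_ge0.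
have a_gt0 : 0 < enorm (wavg V) by rewrite lt_def V_neq0 sqrtr_ge0.
have := cauchy_schwarz ip (diagonal (wavg V)) V.
rewrite wdot_diagonal norm_diagonal -(sqr_dnorm eip) -enormE expr2.
by rewrite ler_pM2l.
Qed.

(** [diagonal (wavg U)] is the orthogonal projection of [U] onto the diagonal
    for the weighted inner product. *)
Definition diag_reflection U := 2 *: diagonal (wavg U) - U.

Lemma diag_reflectionB U V :
  diag_reflection (U - V) = diag_reflection U - diag_reflection V.
Proof.
rewrite /diag_reflection /wavg mulmxBl.
by apply/matrixP => i j; rewrite !mxE; ring.
Qed.

Lemma norm_diag_reflection U : norm (diag_reflection U) = norm U.
Proof.
rewrite /dnorm /diag_reflection; congr Num.sqrt; rewrite !(dotE ip).
rewrite (ip.(dotC) U) !wdot_diagonal wavg_diagonal; ring.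
Qed.

(** The columns enter the update of the mean only through their means, so that
    the mean can be propagated as a variable of its own. *)
Lemma wavg_relaxation (c : R) U V :
  wavg (U + c *: (diagonal (2 *: wavg V - wavg U) - V)) =
  wavg U + c *: (wavg V - wavg U).
Proof.
rewrite {1}/wavg mulmxDl -scalemxAl mulmxBl -!/(wavg _) wavg_diagonal.
by apply/colP => i; move: (wavg U) (wavg V) => u v; rewrite !mxE; ring.
Qed.

Context (P : 'I_J -> 'cV[R]_n -> 'cV[R]_n).
Context (P_subgrad : forall j u,
  subgrad (h j) (P j u) ((w j / gamma) *: (u - P j u))).

Definition prod_prox U : 'M[R]_(n, J) := \matrix_(i, j) P j (col j U) i 0.

Lemma col_prod_prox j U : col j (prod_prox U) = P j (col j U).
Proof. by apply/colP => i; rewrite !mxE. Qed.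

Definition prox_reflection U := 2 *: prod_prox U - U.

(** Monotonicity of the subdifferential leaves only one point [x] for which [u -
    x] is the scaled subgradient. *)
Lemma resolvent_unique j x u (s : 'cV[R]_n) :
  subgrad (h j) x s -> u = x + (gamma / w j) *: s -> P j u = x.
Proof.
move=> xs u_def; have := subgrad_monotone (P_subgrad j u) xs.
have -> : s = (w j / gamma) *: (u - x).
  rewrite u_def addrC addKr scalerA mulrC mulrA mulfVK ?gt_eqF //.
  by rewrite divff ?gt_eqF // scale1r.
rewrite -scalerBr (dotZl eip) pmulr_rge0 ?divr_gt0 //.
have -> : u - P j u - (u - x) = - (P j u - x).
  by rewrite !opprB [LHS]addrC addrA subrK.
rewrite (dotNl eip) oppr_ge0 => le0; apply/eqP; rewrite -subr_eq0.
by apply/eqP/eip.(dot_eq0)/eqP; rewrite eq_le le0 eip.(dot_ge0).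
Qed.

Lemma prox_reflection_nonexpansive U V :
  norm (prox_reflection U - prox_reflection V) <= norm (U - V).
Proof.
pose p := prod_prox U - prod_prox V.
have p_firm : 0 <= '[(U - V) - p, p].
  apply: sumr_ge0 => j _; rewrite mulr_ge0 //; first exact: ltW.
  have -> : col j (U - V - p) = (col j U - P j (col j U)) -
      (col j V - P j (col j V)) by apply/colP => i; rewrite !mxE; ring.
  have -> : col j p = P j (col j U) - P j (col j V).
    by apply/colP => i; rewrite !mxE.
  have := subgrad_monotone (P_subgrad j (col j U)) (P_subgrad j (col j V)).
  by rewrite -scalerBr (dotZl eip) pmulr_rge0 ?divr_gt0.
have -> : prox_reflection U - prox_reflection V = 2 *: p - (U - V).
  by apply/matrixP => i j; rewrite !mxE; ring.
exact: (firm_reflection ip).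
Qed.

Definition dr_operator U := diag_reflection (prox_reflection U).

Lemma dr_operator_nonexpansive U V :
  norm (dr_operator U - dr_operator V) <= norm (U - V).
Proof.
by rewrite -diag_reflectionB norm_diag_reflection prox_reflection_nonexpansive.
Qed.

(** The fixed-point equation says that the proximal points of all the columns
    are equal, to the weighted mean of the reflected point; taking means of both
    sides shows that this common value is [wavg U]. *)
Lemma dr_operator_fixed U : dr_operator U = U ->
  forall j, P j (col j U) = wavg U.
Proof.
rewrite /dr_operator {1}/diag_reflection => U_fixed.
have PU : prod_prox U = diagonal (wavg (prox_reflection U)).
  apply/matrixP => i j; have := congr1 (fun M : 'M[R]_(n, J) => M i j) U_fixed.
  by rewrite !mxE; lra.
have aE : wavg (prox_reflection U) = wavg U.
  have : wavg (prod_prox U) = wavg (prox_reflection U).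
    by rewrite PU wavg_diagonal.
  rewrite /prox_reflection /wavg mulmxBl -scalemxAl => E.
  move: (prod_prox U *m _) (U *m _) E => b u E.
  apply/colP => i; have := congr1 (fun v : 'cV[R]_n => v i 0) E.
  by rewrite !mxE; lra.
by move=> j; rewrite -col_prod_prox PU aE col_diagonal.
Qed.

Context (h_nNy : forall j x, h j x != -oo%E).

(** At a fixed point the subgradients provided by the proximal points are the
    scaled deviations of the columns from their weighted mean, whose weighted
    sum is 0. *)
Lemma dr_fixed_Argmin U : dr_operator U = U ->
  Argmin (fun x => \sum_j h j x)%E (wavg U).
Proof.
move=> /dr_operator_fixed PU.
apply: (@subgrad_sum_Argmin _ _ _ _ _
  (fun j => (w j / gamma) *: (col j U - wavg U))).
  by move=> j; have := P_subgrad j (col j U); rewrite PU.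
rewrite (eq_bigr (fun j => gamma^-1 *: (w j *: col j U - w j *: wavg U))).
  by rewrite -scaler_sumr sumrB -wavgE -scaler_suml w_sum scale1r subrr scaler0.
by move=> j _; rewrite -scalerBr scalerA mulrC.
Qed.

Context (h_convex : forall j, econvex (h j)).

(** The sum rule splits 0 into subgradients [s j] at a minimizer [xhat]; the
    columns [xhat + (gamma / w j) *: s j] then all have [xhat] as proximal point
    and as weighted mean. *)
Lemma dr_fixed_exists z xhat : (forall j, rel_core (edom (h j)) z) ->
  Argmin (fun x => \sum_j h j x)%E xhat -> exists U, dr_operator U = U.
Proof.
move=> z_core xhat_min.
have [s sP s0] := fermat_sum_rule h_nNy h_convex z_core xhat_min.
pose U : 'M[R]_(n, J) := \matrix_(i, j) (xhat + (gamma / w j) *: s j) i 0.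
have col_U j : col j U = xhat + (gamma / w j) *: s j.
  by apply/colP => i; rewrite !mxE.
have PU : prod_prox U = diagonal xhat.
  apply/matrixP => i j; rewrite !mxE col_U.
  by rewrite (resolvent_unique (sP j) erefl).
have aU : wavg U = xhat.
  rewrite wavgE (eq_bigr (fun j => w j *: xhat + gamma *: s j)).
    by rewrite big_split /= -scaler_suml w_sum scale1r -scaler_sumr s0 scaler0
      addr0.
  by move=> j _; rewrite col_U scalerDr scalerA mulrCA divff ?mulr1 // gt_eqF.
exists U; rewrite /dr_operator /prox_reflection PU /diag_reflection.
have -> : wavg (2 *: diagonal xhat - U) = xhat.
  rewrite /wavg mulmxBl -scalemxAl -/(wavg _) -/(wavg _) wavg_diagonal aU.
  by rewrite scaler_nat mulr2n addrK.
by rewrite opprB addrC subrK.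
Qed.

Context (lambda : nat -> R) (lambda02 : forall l, 0 < lambda l < 2).
Context (lambda_sum : forall D : R,
  exists k, D < \sum_(0 <= l < k) lambda l * (2 - lambda l)).
Context (U : nat -> 'M[R]_(n, J)) (err : nat -> 'M[R]_(n, J)).
Context (U_step : forall l, let p := prod_prox (U l) + err l in
  U l.+1 = U l + lambda l *: (diagonal (2 *: wavg p - wavg (U l)) - p)).
Context (B : R).
Context (err_sum : forall k, \sum_(0 <= l < k) lambda l * norm (err l) <= B).

(** A step of length [lambda l] is a relaxation of [dr_operator] of length
    [lambda l / 2], and an error on the proximal points acts through its
    reflection, which has the same norm. *)
Theorem douglas_rachford z xhat : (forall j, rel_core (edom (h j)) z) ->
  Argmin (fun x => \sum_j h j x)%E xhat ->
  exists2 x, Argmin (fun x => \sum_j h j x)%E x &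
    forall e : R, 0 < e -> exists k, forall l, (k <= l)%N ->
      enorm (wavg (U l) - x) < e.
Proof.
move=> z_core xhat_min.
have U_km l : U l.+1 = U l + (lambda l / 2) *: (dr_operator (U l) - U l) +
    lambda l *: diag_reflection (err l).
  rewrite U_step /dr_operator /diag_reflection /prox_reflection /wavg.
  rewrite mulmxBl mulmxDl -scalemxAl.
  by apply/matrixP => i j; rewrite !mxE; field.
have km_sum k :
    \sum_(0 <= l < k) lambda l * norm (diag_reflection (err l)) <= B.
  apply: le_trans (err_sum k); apply: ler_sum => l _.
  by rewrite norm_diag_reflection.
have [V V_fixed U_cvg] := krasnoselskii_mann ip dr_operator_nonexpansive
  lambda02 U_km km_sum lambda_sum (bolzano_wdot w01)
  (dr_fixed_exists z_core xhat_min).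
exists (wavg V); first exact: dr_fixed_Argmin.
move=> e /U_cvg[k kP]; exists k => l /kP; apply: le_lt_trans.
by rewrite /wavg -mulmxBl; exact: ler_enorm_wavg.
Qed.

End ProductSpace.

(** * The algorithm as a Douglas-Rachford iteration *)

Section Series.
Context {R : realType} (u : nat -> R) (u_ge0 : forall l, 0 <= u l).

Lemma nneseries_bounded : (\sum_(0 <= l <oo) (u l)%:E < +oo)%E ->
  exists B : R, forall k, \sum_(0 <= l < k) u l <= B.
Proof.
move=> sum_lt; exists (fine (\sum_(0 <= l <oo) (u l)%:E)) => k.
have sum_ge : (\sum_(0 <= l < k) (u l)%:E <= \sum_(0 <= l <oo) (u l)%:E)%E.
  by apply: nneseries_lim_ge => l _ _; rewrite lee_fin.
rewrite -lee_fin fineK -?sumEFin // ge0_fin_numE //.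
by apply: nneseries_ge0 => l _ _; rewrite lee_fin.
Qed.

Lemma nneseries_unbounded : (\sum_(0 <= l <oo) (u l)%:E = +oo)%E ->
  forall D : R, exists k, D < \sum_(0 <= l < k) u l.
Proof.
move=> sum_oo D; apply: contrapT => no_k.
have : (\sum_(0 <= l <oo) (u l)%:E <= D%:E)%E.
  apply: lime_le; first by apply: is_cvg_nneseries => l _ _; rewrite lee_fin.
  apply: nearW => k; rewrite sumEFin lee_fin leNgt; apply/negP => lt_k.
  by apply: no_k; exists k.
by rewrite sum_oo.
Qed.

End Series.

Lemma big_nat_split_ord (V : nmodType) (S J : nat) (A B : nat -> V) :
  (S <= J)%N ->
  \sum_(1 <= j < S.+1) A j + \sum_(S.+1 <= j < J.+1) B j =
  \sum_(j < J) if (j < S)%N then A j.+1 else B j.+1.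
Proof.
move=> SJ; pose C j := if (j < S)%N then A j.+1 else B j.+1.
rewrite -(big_mkord xpredT C) [RHS](@big_cat_nat _ _ _ S) // !big_add1 /=.
by congr (_ + _); apply: eq_big_nat => j /andP[Sj jS];
  rewrite /C ?jS // ltnNge Sj.
Qed.

Section TightFrame.
Context {R : realType} {K N : nat} (F : 'M[R]_(K, N)) (nu : R).
Context (nu_gt0 : 0 < nu) (tight : F^T *m F = nu%:M).
Implicit Types (phi : 'cV[R]_N -> \bar R).

Lemma edot_mulmx x y : edot (F *m x) y = edot x (F^T *m y).
Proof. by rewrite !edotE trmx_mul mulmxA. Qed.

Lemma analysis_adjointK (y : 'cV[R]_N) : F^T *m (F *m y) = nu *: y.
Proof. by rewrite mulmxA tight mul_scalar_mx. Qed.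

Lemma enorm_analysis x : enorm (F *m x) = Num.sqrt nu * enorm x.
Proof.
rewrite !enormE /dnorm edot_mulmx analysis_adjointK.
by rewrite (dotZr (edot_inner_product N)) sqrtrM // ltW.
Qed.

Lemma econvex_synthesis phi : econvex phi -> econvex (fun x => phi (F^T *m x)).
Proof.
by move=> phi_convex x y t t01; rewrite mulmxDr -!scalemxAr; exact: phi_convex.
Qed.

Lemma subgrad_synthesis phi x s :
  subgrad phi (F^T *m x) s -> subgrad (fun x => phi (F^T *m x)) x (F *m s).
Proof.
move=> [x_fin sP]; split=> // y; have := sP (F^T *m y).
by rewrite edot_mulmx mulmxBr.
Qed.

(** [F^T] is onto, with right inverse [nu^-1 F]. *)
Lemma rel_core_synthesis phi z : rel_core (edom (fun x => phi (F^T *m x))) z ->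
  rel_core (edom phi) (F^T *m z).
Proof.
move=> [z_dom z_core]; split=> // y y_dom.
have yE : F^T *m (nu^-1 *: (F *m y)) = y.
  by rewrite -scalemxAr analysis_adjointK scalerA mulVf ?scale1r ?gt_eqF.
have := z_core (nu^-1 *: (F *m y)); rewrite /edom /= yE => /(_ y_dom).
by apply: filterS => e; rewrite mulmxBr -scalemxAr mulmxBr yE.
Qed.

(** The proximity operator of [phi o F^T] in terms of a proximity operator [p]
    of [phi]: only the component in the range of [F] moves. *)
Definition frame_prox (p : 'cV[R]_N -> 'cV[R]_N) (u : 'cV[R]_K) :=
  u - nu^-1 *: (F *m (F^T *m u - p (F^T *m u))).

Lemma synthesis_frame_prox p u : F^T *m frame_prox p u = p (F^T *m u).
Proof.
rewrite /frame_prox mulmxBr -scalemxAr analysis_adjointK scalerA.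
by rewrite mulVf ?gt_eqF // scale1r subKr.
Qed.

(** The step size is multiplied by [nu] because [F^T] scales distances by
    [Num.sqrt nu] on the range of [F]. *)
Lemma frame_prox_subgrad phi z s (c : R) u : Gamma0 phi -> 0 < c ->
  subgrad phi z s ->
  let p := frame_prox (prox (fun y => (nu * c)%:E * phi y)%E) u in
  subgrad (fun x => phi (F^T *m x)) p (c^-1 *: (u - p)).
Proof.
move=> phi_Gamma0 c_gt0 zs p.
have := prox_subgrad phi_Gamma0 (mulr_gt0 nu_gt0 c_gt0) (F^T *m u) zs.
have -> : u - p = nu^-1 *: (F *m (F^T *m u - F^T *m p)).
  by rewrite synthesis_frame_prox /p /frame_prox subKr.
rewrite -synthesis_frame_prox -/p => /= /subgrad_synthesis.
by rewrite -scalemxAr scalerA invfM mulrC.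
Qed.

End TightFrame.

Section PPXA.
Context {R : realType} {K N : nat} (F : 'M[R]_(K, N)) (nu : R) (S J : nat).
Context (g : nat -> 'cV[R]_N -> \bar R) (f : nat -> 'cV[R]_K -> \bar R).
Context (gamma : R) (omega : nat -> R) (lambda : nat -> R).
Context (atilde : nat -> nat -> 'cV[R]_N) (a : nat -> nat -> 'cV[R]_K).
Context (u0 : nat -> 'cV[R]_K).
Context (nu_gt0 : 0 < nu) (tight : F^T *m F = nu%:M) (SJ : (S <= J)%N).
Context (omega_sum : \sum_(1 <= j < J.+1) omega j = 1).

(** The families indexed from 1 in the two blocks, as one family over 'I_J. *)
Definition term (j : 'I_J) : 'cV[R]_K -> \bar R :=
  if (j < S)%N then fun x => g j.+1 (F^T *m x) else f j.+1.

Definition weight (j : 'I_J) : R := omega j.+1.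

Definition term_prox (j : 'I_J) : 'cV[R]_K -> 'cV[R]_K :=
  if (j < S)%N then
    frame_prox F nu (prox (fun y => (nu * gamma / omega j.+1)%:E * g j.+1 y)%E)
  else prox (fun y => (gamma / omega j.+1)%:E * f j.+1 y)%E.

Definition term_error l : 'M[R]_(K, J) := \matrix_(i, j)
  (if (j < S)%N then F *m atilde j.+1 l else a j.+1 l) i 0.

(** The points u_j of which the algorithm stores, for the first S indices, only
    the component orthogonal to the range of [F] and the image by [F^T]. *)
Definition product_state (s : @ppxa_state R K N) : 'M[R]_(K, J) :=
  \matrix_(i, j) (if (j < S)%N then uperp s j.+1 + nu^-1 *: (F *m vdual s j.+1)
   else uprim s j.+1) i 0.

Lemma col_product_state s j : col j (product_state s) =
  if (j < S)%N then uperp s j.+1 + nu^-1 *: (F *m vdual s j.+1)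
  else uprim s j.+1.
Proof. by apply/colP => i; rewrite !mxE. Qed.

Lemma objectiveE : objective F S J g f = (fun x => \sum_j term j x)%E.
Proof.
apply/funext => x; rewrite /objective big_nat_split_ord //.
by apply: eq_bigr => j _; rewrite /term; case: ifP.
Qed.

Lemma sum_weight : \sum_j weight j = 1.
Proof. by rewrite -omega_sum big_add1 big_mkord. Qed.

Local Notation iter := (ppxa_iter F nu S J g f gamma omega lambda atilde a u0).
Local Notation U := (fun l => product_state (iter l)).

Definition orthogonal_state (s : @ppxa_state R K N) :=
  forall j, (1 <= j <= S)%N -> F^T *m uperp s j = 0.

Lemma orthogonal_part (x : 'cV[R]_K) :
  F^T *m (x - nu^-1 *: (F *m (F^T *m x))) = 0.
Proof.
rewrite mulmxBr -scalemxAr (analysis_adjointK tight) scalerA mulVf ?gt_eqF //.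
by rewrite scale1r subrr.
Qed.

Lemma ppxa_orthogonal l : orthogonal_state (iter l).
Proof.
elim: l => [|l IHl] j jS /=; first exact: orthogonal_part.
rewrite mulmxDr -scalemxAr mulmxBr IHl // orthogonal_part.
by rewrite subrr scaler0 addr0.
Qed.

(** Orthogonality of [uperp] to the range of [F] makes [vdual] the image by
    [F^T] of the reconstructed point, so that the two stored components
    recombine into the proximal step of [g j o F^T]; the analogous splitting of
    [r] lets both components be updated separately. *)
Lemma ppxa_step_product l (s : @ppxa_state R K N) :
  orthogonal_state s -> xiter s = wavg weight (product_state s) ->
  let s' := ppxa_step F nu S J g f gamma omega lambda atilde a l s in
  let p := prod_prox term_prox (product_state s) + term_error l in
  let r := 2 *: wavg weight p - wavg weight (product_state s) in
  product_state s' = product_state s + lambda l *: (diagonal r - p) /\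
  xiter s' = wavg weight (product_state s').
Proof.
move=> s_orth s_avg s' p r.
pose q j := nu^-1 *: prox (fun y => (nu * gamma / omega j)%:E * g j y)%E
  (vdual s j) + atilde j l.
pose pj j := prox (fun y => (gamma / omega j)%:E * f j y)%E (uprim s j) + a j l.
have col_p (j : 'I_J) : col j p =
    if (j < S)%N then uperp s j.+1 + F *m q j.+1 else pj j.+1.
  rewrite /p linearD /= col_prod_prox /term_prox.
  have -> : col j (term_error l) =
      if (j < S)%N then F *m atilde j.+1 l else a j.+1 l.
    by apply/colP => i; rewrite !mxE.
  rewrite col_product_state.
  case: ifP => // jS; rewrite /frame_prox.
  have -> : F^T *m (uperp s j.+1 + nu^-1 *: (F *m vdual s j.+1)) =
      vdual s j.+1.
    rewrite mulmxDr s_orth // add0r -scalemxAr (analysis_adjointK tight).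
    by rewrite scalerA mulVf ?gt_eqF // scale1r.
  rewrite /q mulmxBr scalerBr mulmxDr -scalemxAr.
  by apply/colP => i; rewrite !mxE; ring.
have p_avg : wavg weight p = \sum_(1 <= j < S.+1) omega j *: uperp s j
    + F *m (\sum_(1 <= j < S.+1) omega j *: q j)
    + \sum_(S.+1 <= j < J.+1) omega j *: pj j.
  rewrite mulmx_sumr -big_split /= big_nat_split_ord // wavgE.
  apply: eq_bigr => j _; rewrite col_p; case: ifP => // _.
  by rewrite -scalemxAr scalerDr.
have x_step : xiter s' = wavg weight (product_state s) +
    lambda l *: (wavg weight p - wavg weight (product_state s)).
  by rewrite p_avg -s_avg.
have r_def : r = 2 *: wavg weight p - xiter s by rewrite s_avg.
have s'_uperp j : uperp s' j = uperp s j +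
    lambda l *: (r - nu^-1 *: (F *m (F^T *m r)) - uperp s j).
  by rewrite r_def p_avg.
have s'_vdual j : vdual s' j = vdual s j + lambda l *: (F^T *m r - nu *: q j).
  by rewrite r_def p_avg.
have s'_uprim j : uprim s' j = uprim s j + lambda l *: (r - pj j).
  by rewrite r_def p_avg.
have U_step : product_state s' =
    product_state s + lambda l *: (diagonal r - p).
  have colE j : col j (product_state s') =
      col j (product_state s) + lambda l *: (r - col j p).
    rewrite !col_product_state col_p; case: ifP => jS.
      rewrite s'_uperp s'_vdual; move: (q j.+1) (r) => qj r'.
      rewrite (mulmxDr F) -scalemxAr (mulmxBr F) -scalemxAr.
      move: (uperp s _) (F *m _) (F *m _) (F *m _) => up Fr Fv Fq.
      by apply/colP => i; rewrite !mxE; field; rewrite gt_eqF.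
    by rewrite s'_uprim.
  apply/matrixP => i j; have := congr1 (fun v : 'cV_K => v i 0) (colE j).
  by rewrite ![col _ _ _ _]mxE => ->; rewrite !mxE.
by split=> //; rewrite x_step U_step wavg_relaxation // sum_weight.
Qed.

Lemma ppxa_product l : xiter (iter l) = wavg weight (U l).
Proof.
elim: l => [|l IHl]; last first.
  by have [] := ppxa_step_product l (@ppxa_orthogonal l) IHl.
rewrite wavgE /= big_add1 big_mkord; apply: eq_bigr => j _; congr (_ *: _).
by apply/colP => i; rewrite !mxE; case: ifP => // _; rewrite !mxE subrK.
Qed.

Lemma ppxa_recurrence l :
  let p := prod_prox term_prox (U l) + term_error l in
  U l.+1 = U l +
    lambda l *: (diagonal (2 *: wavg weight p - wavg weight (U l)) - p).
Proof.
by have [] := ppxa_step_product l (@ppxa_orthogonal l) (ppxa_product l).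
Qed.

End PPXA.

Theorem mainTheorem3 (R : realType) (K N : nat) (F : 'M[R]_(K, N)) (nu : R)
  (S J : nat)
  (g : nat -> 'cV[R]_N -> \bar R) (f : nat -> 'cV[R]_K -> \bar R)
  (gamma : R) (omega : nat -> R) (lambda : nat -> R)
  (atilde : nat -> nat -> 'cV[R]_N) (a : nat -> nat -> 'cV[R]_K)
  (u0 : nat -> 'cV[R]_K)
  (nu_gt0 : 0 < nu)
  (tight : F^T *m F = nu%:M)
  (S_range : (1 <= S <= J)%N)
  (g_Gamma0 : forall j, (1 <= j <= S)%N -> Gamma0 (g j))
  (f_Gamma0 : forall j, (S.+1 <= j <= J)%N -> Gamma0 (f j))
  (gamma_gt0 : 0 < gamma)
  (omega_range : forall j, (1 <= j <= J)%N -> 0 < omega j <= 1)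
  (omega_sum : \sum_(1 <= j < J.+1) omega j = 1)
  (lambda_range : forall l, 0 < lambda l < 2)
  (obj_coercive : coercive (objective F S J g f))
  (qualification :
    (\bigcap_(j in [set j | (1 <= j <= S)%N])
        rint (edom (fun x => g j (F^T *m x)))) `&`
    (\bigcap_(j in [set j | (S.+1 <= j <= J)%N]) rint (edom (f j))) !=set0)
  (atilde_sum : forall j, (1 <= j <= S)%N ->
    (\sum_(0 <= l <oo) (lambda l * enorm (atilde j l))%:E < +oo)%E)
  (a_sum : forall j, (S.+1 <= j <= J)%N ->
    (\sum_(0 <= l <oo) (lambda l * enorm (a j l))%:E < +oo)%E)
  (lambda_sum : (\sum_(0 <= l <oo) (lambda l * (2 - lambda l))%:E = +oo)%E) :
  exists2 xhat : 'cV[R]_K, Argmin (objective F S J g f) xhat &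
    ppxa F nu S J g f gamma omega lambda atilde a u0 @ \oo --> xhat.
Proof.
have /andP[_ SJ] := S_range.
have omega_gt0 j : (1 <= j <= J)%N -> 0 < omega j by case/omega_range/andP.
have w01 (j : 'I_J) : 0 < weight omega j <= 1.
  by apply: omega_range; rewrite /= ltn_ord.
have w_sum := sum_weight omega_sum.
pose h := @term R K N F S J g f.
have h_cases (Q : ('cV[R]_K -> \bar R) -> Prop) :
    (forall j, (1 <= j <= S)%N -> Q (fun x => g j (F^T *m x))) ->
    (forall j, (S.+1 <= j <= J)%N -> Q (f j)) -> forall j, Q (h j).
  move=> Qg Qf j; rewrite /h /term; case: ltnP => jS; first exact: Qg.
  by apply: Qf; rewrite ltnS jS ltn_ord.
have h_nNy j x : h j x != -oo%E.
  move: j x; apply: (h_cases (fun phi => forall x, phi x != -oo%E)) => j.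
    by case/g_Gamma0=> -[gN _] _ _ x; exact: gN.
  by case/f_Gamma0=> -[fN _] _ _.
have h_convex : forall j, econvex (h j).
  apply: (h_cases econvex) => j; last by case/f_Gamma0.
  by case/g_Gamma0=> _ _; exact: econvex_synthesis.
have h_lsc : forall j, elsc (h j).
  apply: (h_cases (@elsc R K)) => j.
    by case/g_Gamma0=> _ /lower_semicontinuous_elsc g_lsc _; exact: elsc_mulmx.
  by case/f_Gamma0=> _ /lower_semicontinuous_elsc.
have [z [zg zf]] := qualification.
have z_core : forall j, rel_core (edom (h j)) z.
  apply: (h_cases (fun phi => rel_core (edom phi) z)) => j jS.
    exact/rint_rel_core/zg.
  exact/rint_rel_core/zf.
(* A subgradient at the qualification point z is what makes the proximal points
   exist. *)
have P_subgrad (j : 'I_J) u : let p := term_prox F nu S g f gamma omega j u in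
    subgrad (h j) p ((weight omega j / gamma) *: (u - p)).
  have := z_core j; rewrite /h /term /term_prox /weight -[_ / gamma]invf_div.
  have c_gt0 : 0 < gamma / omega j.+1.
    by rewrite divr_gt0 // omega_gt0 //= ltn_ord.
  case: ltnP => jS z_j.
    have gj := g_Gamma0 j.+1 jS.
    have [s zs] : exists s, subgrad (g j.+1) (F^T *m z) s.
      case: (gj) => -[gN _] _ g_convex.
      exact: rel_core_subgrad gN g_convex (rel_core_synthesis nu_gt0 tight z_j).
    by rewrite -mulrA; exact: (frame_prox_subgrad nu_gt0 tight u gj c_gt0 zs).
  have fj : Gamma0 (f j.+1) by apply: f_Gamma0; rewrite ltnS jS ltn_ord.
  have [s zs] : exists s, subgrad (f j.+1) z s.
    by case: (fj) => -[fN _] _ f_convex; exact: rel_core_subgrad.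
  exact: (prox_subgrad fj c_gt0 u zs).
have objE := objectiveE F g f SJ.
have obj_sum_lsc : elsc (fun x => \sum_j h j x)%E by exact: elsc_sum.
have [xhat xhat_min] : exists x, Argmin (fun x => \sum_j h j x)%E x.
  apply: elsc_coercive_Argmin => //; last by rewrite -objE.
  by move=> x; apply/eqP => /esum_eqNyP[j [_ _]]; exact/eqP/h_nNy.
have lambda_ge0 l : 0 <= lambda l by have /andP[/ltW] := lambda_range l.
have lambda_unbounded : forall D : R,
    exists k, D < \sum_(0 <= l < k) lambda l * (2 - lambda l).
  apply: nneseries_unbounded => // l; have /andP[_ l2] := lambda_range l.
  by rewrite mulr_ge0 // subr_ge0 ltW.
(* On the first block the errors are those of atilde seen through F. *)
have err_bounded (j : 'I_J) : exists B : R, forall k, \sum_(0 <= l < k)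
    lambda l * enorm (col j (term_error F S J atilde a l)) <= B.
  have enorm_ge0 n (x : 'cV[R]_n) : 0 <= enorm x by exact: sqrtr_ge0.
  have col_err l : col j (term_error F S J atilde a l) =
      if (j < S)%N then F *m atilde j.+1 l else a j.+1 l.
    by apply/colP => i; rewrite !mxE.
  have [jS|Sj] := ltnP j S; last first.
    have [||B BP] :=
      @nneseries_bounded _ (fun l => lambda l * enorm (a j.+1 l)).
    - by move=> l; rewrite mulr_ge0.
    - by apply: a_sum; rewrite ltnS Sj ltn_ord.
    exists B => k; apply: le_trans (BP k); apply: ler_sum => l _.
    by rewrite col_err ltnNge Sj.
  have [||B BP] :=
      @nneseries_bounded _ (fun l => lambda l * enorm (atilde j.+1 l)).
  - by move=> l; rewrite mulr_ge0.
  - exact: atilde_sum.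
  exists (Num.sqrt nu * B) => k.
  apply: le_trans (ler_wpM2l (sqrtr_ge0 nu) (BP k)).
  rewrite mulr_sumr; apply: ler_sum => l _.
  by rewrite col_err jS (enorm_analysis nu_gt0 tight) mulrCA.
have /choice[B BP] := err_bounded.
have err_sum k : \sum_(0 <= l < k) lambda l *
    dnorm (wdot (weight omega (J := J))) (term_error F S J atilde a l) <=
    \sum_j B j.
  apply: le_trans (_ : \sum_(0 <= l < k) \sum_j
      lambda l * enorm (col j (term_error F S J atilde a l)) <= _).
    by apply: ler_sum => l _; rewrite -mulr_sumr ler_wpM2l // ler_dnorm_wdot.
  by rewrite exchange_big; apply: ler_sum => j _; exact: BP.
pose iter := ppxa_iter F nu S J g f gamma omega lambda atilde a u0.
have U_step := ppxa_recurrence g f gamma lambda atilde a u0 nu_gt0 tight SJ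
  omega_sum.
have [x x_min x_cvg] := douglas_rachford gamma_gt0 w01 w_sum P_subgrad h_nNy
  h_convex lambda_range lambda_unbounded
  (U := fun l => product_state F nu S J (iter l)) U_step err_sum z_core
  xhat_min.
exists x; first by rewrite objE.
apply/cvgrPdist_lt => e e_gt0; have [k kP] := x_cvg e e_gt0.
exists k => // l /= kl; rewrite distrC.
apply: le_lt_trans (ler_mx_norm_enorm _) _.
rewrite /ppxa.
rewrite (ppxa_product g f gamma lambda atilde a u0 nu_gt0 tight SJ omega_sum).
exact: kP.
Qed.
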